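(* Let $\mathcal P$ be a $(\lambda_1,\lambda_2)$-good grid of a finite measure space $(I,\mathbb A,m)$, $p\in[1,\infty)$, $q\in[1,\infty]$ and $0<s<1/p$. Let $g,f\in\mathcal B^s_{p,q}\cap L^\infty$. Then $g\cdot f\in\mathcal B^s_{p,q}\cap L^\infty$ and $$|f\cdot g|_{\mathcal B^s_{p,q}}+|f\cdot g|_\infty\le C_eC_o\,(|f|_{\mathcal B^s_{p,q}}+|f|_\infty)(|g|_{\mathcal B^s_{p,q}}+|g|_\infty).$$ So $\mathcal B^s_{p,q}\cap L^\infty$ is a quasi-Banach algebra. Here $$C_e=1+C_H\max\{\lambda_2^{1/p-s},\lambda_1^{1/p-s}\}\lambda_1^{-2-1/p},\qquad C_H=\frac{\lambda_2^{1/2}}{\sqrt2\,\lambda_1^{3/2}}+1,\qquad C_o=\Gamma\,|I|^{-s}+\frac1{1-\lambda_2^s},$$ with $\Gamma=(\sum_k|\mathcal P^k|^{sq'})^{1/q'}$ if $q>1$ and $\Gamma=\sup_k|\mathcal P^k|^s$ if $q=1$.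
   Context: $|J|=m(J)$; $\mathbb N=\{0,1,\dots\}$; $|\mathcal P^k|=\max\{|Q|:Q\in\mathcal P^k\}$; $1/q+1/q'=1$ ($\infty'=1$); sup modification when $q=\infty$. $\mathcal B^s_{p,q}\cap L^\infty$ carries the norm $|\cdot|_{\mathcal B^s_{p,q}}+|\cdot|_\infty$; ''quasi-Banach algebra'' means: complete normed space closed under multiplication, with the norm of a product at most a constant times the product of the norms. Good grid ($0<\lambda_1<\lambda_2<1$): a sequence $\mathcal P=(\mathcal P^k)_{k\in\mathbb N}$ of finite families of measurable sets of positive measure with: $\mathcal P^0=\{I\}$; $I=\bigcup_{Q\in\mathcal P^k}Q$ up to a null set; the elements of $\mathcal P^k$ are pairwise disjoint; every $Q\in\mathcal P^k$, $k>0$, is contained in some $P\in\mathcal P^{k-1}$; $\lambda_1\le|Q|/|P|\le\lambda_2$ whenever $Q\subset P$, $Q\in\mathcal P^{k+1}$, $P\in\mathcal P^k$; $\bigcup_k\mathcal P^k$ generates $\mathbb A$. An $(s,p)$-Souza's atom on $Q\in\bigcup_k\mathcal P^k$ is a function constant on $Q$, zero outside $Q$, with sup norm $\le|Q|^{s-1/p}$. $\mathcal B^s_{p,q}$ is the set of complex $g\in L^p$ which can be written $g=\sum_k\sum_{Q\in\mathcal P^k}s_Qa_Q$ with $a_Q$ an $(s,p)$-Souza's atom on $Q$, $s_Q\in\mathbb C$, $\sum_k|\sum_{Q\in\mathcal P^k}s_Qa_Q|_p<\infty$ and finite cost $(\sum_k(\sum_{Q\in\mathcal P^k}|s_Q|^p)^{q/p})^{1/q}$;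 $|g|_{\mathcal B^s_{p,q}}$ is the infimum of the costs. *)

(* Defs.v *)
From HB Require Import structures.
From mathcomp Require Import all_boot all_order all_algebra.
From mathcomp Require Import all_classical all_reals all_analysis.
From mathcomp Require Import complex.
Set Implicit Arguments.
Unset Strict Implicit.
Unset Printing Implicit Defensive.
Import Order.TTheory GRing.Theory Num.Theory.
Import numFieldNormedType.Exports.
Local Open Scope classical_set_scope.
Local Open Scope ring_scope.

Section complex_Lp.
Context {d : measure_display} {T : measurableType d} {R : realType}.
Variable m : {measure set T -> \bar R}.
Implicit Types (f : T -> R[i]) (p : \bar R).

(* The library puts no measurable structure on R[i]; it is R x R. *)
Definition cmeasurable f : Prop :=
  measurable_fun setT (fun x => complex.Re (f x)) /\
  measurable_fun setT (fun x => complex.Im (f x)).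

(* [Normc.normc] is the modulus with values in [R]; the generic norm of
   [R[i]] takes its values in [R[i]]. *)
Definition cLnorm p f : \bar R :=
  Lnorm m p (fun x => (Normc.normc (f x))%:E).

Definition cLp p : set (T -> R[i]) :=
  [set f | cmeasurable f /\ (cLnorm p f < +oo)%E].

End complex_Lp.

Section grids.
Context {d : measure_display} {T : measurableType d} {R : realType}.
Variable m : {finite_measure set T -> \bar R}.
Implicit Types (P : nat -> set (set T)) (Q : set T).

Definition vol Q : R := fine (m Q).

(* The ambient space I is the whole type T. *)
Record good_grid (l1 l2 : R) P : Prop := GoodGrid {
  gg_lambda : 0 < l1 /\ l1 < l2 /\ l2 < 1;
  gg_finite : forall k, finite_set (P k);
  gg_measurable : forall k Q, P k Q -> measurable Q;
  gg_pos : forall k Q, P k Q -> (0 < m Q)%E;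
  gg_root : P 0%N = [set setT];
  gg_cover : forall k, m (~` \bigcup_(Q in P k) Q) = 0%E;
  gg_disjoint : forall k, trivIset (P k) id;
  gg_nested : forall k Q, P k.+1 Q -> exists2 Q', P k Q' & Q `<=` Q';
  gg_ratio : forall k Q Q', P k.+1 Q -> P k Q' -> Q `<=` Q' ->
    l1 <= vol Q / vol Q' <= l2;
  gg_generates : <<s \bigcup_k P k >> = @measurable d T
}.

(* maximal measure of the elements of the k-th family *)
Definition mesh P (k : nat) : R := \big[Num.max/0]_(Q \in P k) vol Q.

End grids.

Section besov.
Context {d : measure_display} {T : measurableType d} {R : realType}.
Variable m : {finite_measure set T -> \bar R}.
Variable P : nat -> set (set T).
Implicit Types (s p : R) (q : \bar R) (f g : T -> R[i]).

Definition souza_atom s p (Q : set T) (a : T -> R[i]) : Prop :=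
  [/\ forall x y, Q x -> Q y -> a x = a y,
      forall x, ~ Q x -> a x = 0 &
      forall x, Normc.normc (a x) <= vol m Q `^ (s - p^-1)].

Definition level (c : set T -> R[i]) (a : set T -> T -> R[i]) (k : nat)
    : T -> R[i] :=
  fun x => \sum_(Q \in P k) c Q * a Q x.

(* The grid levels are pairwise disjoint families, so coefficients and atoms
   are indexed by the cell alone.  The series is summed in L^p. *)
Record atomic_rep s p g (c : set T -> R[i]) (a : set T -> T -> R[i]) : Prop :=
  AtomicRep {
  ar_atom : forall k Q, P k Q -> souza_atom s p Q (a Q);
  ar_abs : (\sum_(k <oo) cLnorm m p%:E (level c a k) < +oo)%E;
  ar_sum : (fun n : nat =>
      cLnorm m p%:E (fun x => g x - \sum_(k < n) level c a k x)) @ \oo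
    --> 0%E
}.

Definition level_sum p (c : set T -> R[i]) (k : nat) : R :=
  \sum_(Q \in P k) Normc.normc (c Q) `^ p.

(* only used for 1 <= q <= +oo *)
Definition cost p q (c : set T -> R[i]) : \bar R :=
  match q with
  | r%:E => ((\sum_(k <oo) (level_sum p c k `^ (r / p))%:E) `^ r^-1)%E
  | _ => ereal_sup (range (fun k => (level_sum p c k `^ p^-1)%:E))
  end.

Definition besov s p q : set (T -> R[i]) :=
  [set g | cLp m p%:E g /\
    exists c a, atomic_rep s p g c a /\ (cost p q c < +oo)%E].

Definition besov_norm s p q g : \bar R :=
  ereal_inf [set z | exists c a, atomic_rep s p g c a /\ z = cost p q c].

Definition besov_Linfty s p q : set (T -> R[i]) :=
  besov s p q `&` cLp m +oo%E.

Definition besov_Linfty_norm s p q g : \bar R :=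
  (besov_norm s p q g + cLnorm m +oo%E g)%E.

End besov.

(* [A] is a set of functions standing for the set of their classes modulo
   equality almost everywhere, [N] a norm on these classes, multiplication is
   pointwise. *)
Record quasi_banach_algebra {d : measure_display} {T : measurableType d}
    {R : realType} (m : {measure set T -> \bar R})
    (A : set (T -> R[i])) (N : (T -> R[i]) -> \bar R) : Prop :=
  QuasiBanachAlgebra {
  qba_measurable : forall f, A f -> cmeasurable f;
  qba_ae : forall f g, A f -> cmeasurable g -> ae_eq m setT f g ->
    A g /\ N g = N f;
  qba_zero : A (fun=> 0);
  qba_add : forall f g, A f -> A g -> A (f \+ g);
  qba_scale : forall (c : R[i]) f, A f -> A (fun x => c * f x);
  qba_norm_ge0 : forall f, A f -> (0 <= N f < +oo)%E;
  qba_norm_eq0 : forall f, A f -> (N f = 0%E <-> ae_eq m setT f (fun=> 0));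
  qba_norm_add : forall f g, A f -> A g -> (N (f \+ g)%R <= N f + N g)%E;
  qba_norm_scale : forall (c : R[i]) f, A f ->
    N (fun x => (c * f x)%R) = ((Normc.normc c)%:E * N f)%E;
  qba_complete : forall u : nat -> T -> R[i], (forall n, A (u n)) ->
    (forall e : R, 0 < e -> exists n0 : nat, forall i j : nat,
      (n0 <= i)%N -> (n0 <= j)%N -> (N (u i \- u j)%R < e%:E)%E) ->
    exists2 f, A f & (fun n : nat => N (u n \- f)) @ \oo --> 0%E;
  qba_mul : forall f g, A f -> A g -> A (f \* g);
  qba_norm_mul : exists C : R, forall f g, A f -> A g ->
    (N (f \* g)%R <= C%:E * N f * N g)%E
}.

Section constants.
Context {d : measure_display} {T : measurableType d} {R : realType}.
Variable m : {finite_measure set T -> \bar R}.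
Implicit Types (s p : R) (q : \bar R).

Definition C_H (l1 l2 : R) : R :=
  l2 `^ 2^-1 / (Num.sqrt 2 * l1 `^ (3 / 2)) + 1.

Definition C_e (l1 l2 : R) s p : R :=
  1 + C_H l1 l2 * Num.max (l2 `^ (p^-1 - s)) (l1 `^ (p^-1 - s))
      * l1 `^ (- 2 - p^-1).

(* [hoelder_conjugate 1 = +oo], which selects the supremum. *)
Definition Gamma (P : nat -> set (set T)) s q : \bar R :=
  match hoelder_conjugate q with
  | r%:E => ((\sum_(k <oo) (mesh m P k `^ (s * r))%:E) `^ r^-1)%E
  | _ => ereal_sup (range (fun k => (mesh m P k `^ s)%:E))
  end.

Definition C_o (P : nat -> set (set T)) (l2 : R) s q : \bar R :=
  (Gamma P s q * (vol m setT `^ (- s))%:E + (1 / (1 - l2 `^ s))%:E)%E.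

End constants.

(* Main.v *)
Require Import Defs.
From HB Require Import structures.
From mathcomp Require Import all_boot all_order all_algebra.
From mathcomp Require Import all_classical all_reals all_analysis.
From mathcomp Require Import ess_sup_inf measurable_realfun.
From mathcomp Require Import complex lra ring.
Set Implicit Arguments.
Unset Strict Implicit.
Unset Printing Implicit Defensive.
Import Order.TTheory GRing.Theory Num.Theory.
Import numFieldNormedType.Exports.
Local Open Scope classical_set_scope.
Local Open Scope ring_scope.

(* Let E_k f be the function whose value on each cell of the k-th level is the
   average of f there.  The martingale differences E_k f - E_(k-1) f give a
   representation of f by Souza's atoms, and its cost is at most
   (1 + l1^(-1/p)) / (1 - l2^s) times the cost of any other representation:
   by Jensen's inequality the i-th level of a representation contributes to the
   k-th difference at most l2^((i-k)s) times its l^p cost when k <= i, and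
   nothing when i < k, so Minkowski's inequality and a geometric series suffice.

   Unlike the partial sums of an arbitrary representation, the E_k f are bounded
   by |f|_oo.  Hence fg has a representation by the differences of E_k f E_k g,
   and the discrete Leibniz rule bounds its cost by
   |g|_oo (standard cost of f) + |f|_oo (standard cost of g).
   The constant obtained is already below C_e / (1 - l2^s).

   Each coefficient of the martingale representation is continuous for the L^p
   distance, so its cost is lower semicontinuous; this gives completeness. *)

(** Origin of the constant: the coefficient at a cell Q involves the averages over Q and over its
    parent. A parent is counted once per child, hence at most 1/l1 times, which gives l1^(-1/p)
    after the p-th root; since s < 1/p, the weight |Q|^(1/p - s) of a child does not exceed that of
    its parent. A normalized atom has L^p norm |Q|^s and volumes shrink at least by l2 per
    generation, so each generation between k and i contributes a factor l2^s.

    Averages commute with finite sums by linearity alone. The comparison of costs is therefore made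
    for partial sums of a representation, with a bound independent of their length, and reaches f by
    L^p approximation. The same approximation, together with the L^p contractivity of E_k, yields
    E_k f -> f in L^p for every f in the Besov space.

    Costs are handled through their truncations to finitely many levels. These are real numbers,
    treated alike for all q, and they involve finitely many coefficients, so a continuity bound that
    depends on the truncation is good enough. *)

Local Notation nc := Normc.normc.

(** * Finite l^q norms *)

Section powR_facts.
Context {R : realType}.
Implicit Types (a b p t x y : R).

Lemma ler_powRl p x y : 0 <= p -> 0 <= x -> x <= y -> x `^ p <= y `^ p.
Proof.
by move=> p0 x0 xy; apply: ge0_ler_powR => //; rewrite nnegrE// (le_trans x0).
Qed.

Lemma powRK p x : 0 <= x -> p != 0 -> (x `^ p) `^ p^-1 = x.
Proof. by move=> x0 p0; rewrite -powRrM mulfV// powRr1. Qed.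

Lemma powRVK p x : 0 <= x -> p != 0 -> (x `^ p^-1) `^ p = x.
Proof. by move=> x0 p0; rewrite -powRrM mulVf// powRr1. Qed.

Lemma powRV_le p x y : 0 < p -> 0 <= x -> 0 <= y ->
  (x `^ p^-1 <= y) = (x <= y `^ p).
Proof.
move=> p0 x0 y0; have pn0 : p != 0 by rewrite gt_eqF.
apply/idP/idP => h.
  by rewrite -(powRVK x0 pn0); apply: ler_powRl (ltW p0) (powR_ge0 _ _) h.
by rewrite -(powRK y0 pn0); apply: ler_powRl h => //; rewrite invr_ge0 ltW.
Qed.

(* The tangent line of [t `^ p] at [t = y] stays below the graph. *)
Lemma powR_tangent p y t : 1 <= p -> 0 <= y -> 0 <= t ->
  y `^ (p - 1) * t <= p^-1 * t `^ p + (1 - p^-1) * y `^ p.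
Proof.
move=> p1 y0 t0; have p0 : 0 < p by rewrite (lt_le_trans _ p1).
have [->|pn1] := eqVneq p 1.
  by rewrite subrr powRr0 invr1 subrr mul0r addr0 powRr1.
have p1' : 0 < p - 1 by rewrite subr_gt0 lt_def pn1.
have q0 : 0 < p / (p - 1) by rewrite divr_gt0.
have pq : p^-1 + (p / (p - 1))^-1 = 1 by rewrite invf_div; field; lra.
(* Young's inequality for [t] and [y ^ (p - 1)] with the exponents [p] and [p / (p - 1)]. *)
have := conjugate_powR t0 (powR_ge0 y (p - 1)) p0 q0 pq.
rewrite -powRrM mulrCA mulfV ?gt_eqF// mulr1 mulrC => /le_trans; apply.
rewrite mulrC lerD2l mulrC ler_wpM2r ?powR_ge0//.
suff -> : (p / (p - 1))^-1 = 1 - p^-1 by [].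
by rewrite -[LHS](addKr p^-1) pq addrC.
Qed.

(** The tangent lines at the convex combination [z], taken at [x] and at [y], are averaged with the
    weights [u] and [v]; their linear parts add up to [z ^ p]. *)
Lemma jensen_powR2 p (u v x y : R) : 1 <= p -> 0 <= u -> 0 <= v -> u + v = 1 ->
  0 <= x -> 0 <= y ->
  (u * x + v * y) `^ p <= u * x `^ p + v * y `^ p.
Proof.
move=> p1 u0 v0 uv1 x0 y0; have p0 : 0 < p by rewrite (lt_le_trans _ p1).
set z := u * x + v * y.
have z0 : 0 <= z by rewrite addr_ge0 ?mulr_ge0.
have hx := ler_wpM2l u0 (powR_tangent p1 z0 x0).
have hy := ler_wpM2l v0 (powR_tangent p1 z0 y0).
have := lerD hx hy.
have -> : u * (z `^ (p - 1) * x) + v * (z `^ (p - 1) * y) = z `^ p.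
  by rewrite -(mulr_powRB1 z0 p0) /z; ring.
have -> : u * (p^-1 * x `^ p + (1 - p^-1) * z `^ p) +
   v * (p^-1 * y `^ p + (1 - p^-1) * z `^ p) =
   p^-1 * (u * x `^ p + v * y `^ p) + (1 - p^-1) * z `^ p.
  have -> : v = 1 - u by lra.
  ring.
rewrite mulrBl mul1r => h.
have : p^-1 * z `^ p <= p^-1 * (u * x `^ p + v * y `^ p) by lra.
by rewrite ler_pM2l// invr_gt0.
Qed.

End powR_facts.

Section lnorm.
Context {R : realType} {I : eqType}.
Implicit Types (q : \bar R) (r : seq I) (a b : I -> R) (M : R).

(** A finite index list keeps the norm in [R]. The same definition measures the coefficients of one
    level and the sequence of levels; the value at [-oo] is a convention. *)
Definition lnorm q r a : R :=
  match q with
  | t%:E => (\sum_(i <- r) a i `^ t) `^ t^-1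
  | _ => \big[Num.max/0]_(i <- r) a i
  end.

Lemma lnorm_ge0 q r a : 0 <= lnorm q r a.
Proof.
case: q => [t|/=|/=]; first exact: powR_ge0.
- exact: bigmax_ge_id.
- exact: bigmax_ge_id.
Qed.

Lemma lnorm_fin_leP (t : R) r a M : 0 < t -> 0 <= M ->
  (lnorm t%:E r a <= M) = (\sum_(i <- r) a i `^ t <= M `^ t).
Proof.
by move=> t0 M0; rewrite /lnorm powRV_le// sumr_ge0// => i _; exact: powR_ge0.
Qed.

Lemma lnorm_infty_leP q r a M : (forall t, q <> t%:E) -> 0 <= M ->
  lnorm q r a <= M <-> (forall i, i \in r -> a i <= M).
Proof.
move=> qt M0; rewrite /lnorm; case: q qt => [t /(_ t)//|_|_];
  (split=> [h i ir|h]; [apply: le_trans h; exact: le_bigmax_seq|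
    by rewrite big_seq; elim/big_ind: _ => // x y xM yM; rewrite ge_max xM]).
Qed.

Lemma eq_lnorm q r a b : {in r, a =1 b} -> lnorm q r a = lnorm q r b.
Proof.
move=> ab; rewrite /lnorm; case: q => [t|/=|/=].
- by congr (_ `^ _); apply: eq_big_seq => i /ab ->.
- by apply: eq_big_seq => i /ab ->.
- by apply: eq_big_seq => i /ab ->.
Qed.

Lemma ler_lnorm q r a b : (1 <= q)%E ->
  (forall i, i \in r -> 0 <= a i <= b i) -> lnorm q r a <= lnorm q r b.
Proof.
case: q => [t t1|_|//] ab.
  have t0 : 0 < t by rewrite (lt_le_trans ltr01).
  rewrite lnorm_fin_leP ?lnorm_ge0//.
  rewrite /= powRVK ?gt_eqF//; last by rewrite sumr_ge0// => i _; exact: powR_ge0.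
  rewrite big_seq [leRHS]big_seq ler_sum// => i /ab /andP[a0 aib].
  by rewrite ler_powRl// ltW.
apply/lnorm_infty_leP => // [|i ir]; first exact: lnorm_ge0.
have /andP[_ /le_trans] := ab _ ir; apply.
exact: le_bigmax_seq.
Qed.

Lemma lnormZ q r a M : (1 <= q)%E -> 0 <= M -> (forall i, i \in r -> 0 <= a i) ->
  lnorm q r (fun i => M * a i) = M * lnorm q r a.
Proof.
case: q => [t t1|_|//] M0 a0.
  have t0 : 0 < t by rewrite (lt_le_trans ltr01).
  rewrite /lnorm big_seq; under eq_bigr => i ir do rewrite powRM ?a0//.
  rewrite -big_distrr /= powRM ?powR_ge0//.
    by rewrite powRK// ?gt_eqF// -big_seq.
  by rewrite sumr_ge0// => i _; exact: powR_ge0.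
rewrite /=; apply: (big_ind2 (fun x y => x = M * y)) => //; first by rewrite mulr0.
by move=> _ x _ y -> ->; rewrite -maxr_pMr.
Qed.

Lemma le_lnorm q r a i : (1 <= q)%E -> (forall i, i \in r -> 0 <= a i) ->
  i \in r -> a i <= lnorm q r a.
Proof.
case: q => [t t1|_|//] a0 ir; last exact: le_bigmax_seq.
have t0 : 0 < t by rewrite (lt_le_trans ltr01).
rewrite -{1}(powRK (a0 _ ir) (lt0r_neq0 t0)) /lnorm.
apply: ler_powRl; rewrite ?powR_ge0 ?invr_ge0 ?(ltW t0)//.
by rewrite (big_rem i ir)/= lerDl sumr_ge0// => j _; exact: powR_ge0.
Qed.

(** Minkowski's inequality from convexity: [a + b] is [A + B] times the convex combination of
    [a / A] and [b / B] with weights [A / (A + B)] and [B / (A + B)]. Strictly positive bounds, in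
    place of the norms themselves, make the divisions legitimate; [lnormD] removes them by a small
    slack. *)
Lemma lnormD_le q r a b (A B : R) : (1 <= q)%E ->
  (forall i, i \in r -> 0 <= a i) -> (forall i, i \in r -> 0 <= b i) ->
  0 < A -> 0 < B -> lnorm q r a <= A -> lnorm q r b <= B ->
  lnorm q r (fun i => a i + b i) <= A + B.
Proof.
move=> q1 a0 b0 A0 B0; have AB0 : 0 < A + B by rewrite addr_gt0.
case: q q1 => [t t1|_|//]; last first.
  move=> /lnorm_infty_leP hA /lnorm_infty_leP hB.
  apply/lnorm_infty_leP => // [|i ir]; first exact: ltW.
  by rewrite lerD ?hA ?hB// ltW.
have t0 : 0 < t by rewrite (lt_le_trans ltr01).
have leP c (C : R) : 0 < C ->
    lnorm t%:E r c <= C <-> \sum_(i <- r) c i `^ t <= C `^ t.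
  by move=> C0; rewrite lnorm_fin_leP// ltW.
move=> /(leP _ _ A0) hA /(leP _ _ B0) hB; apply/(leP _ _ AB0).
pose u := A / (A + B); pose v := B / (A + B).
have u0 : 0 <= u by rewrite divr_ge0// ltW.
have v0 : 0 <= v by rewrite divr_ge0// ltW.
have uv1 : u + v = 1 by rewrite /u /v -mulrDl divff// gt_eqF.
have pt i : i \in r -> (a i + b i) `^ t <=
    (A + B) `^ t * (u * (A^-1 `^ t * a i `^ t) + v * (B^-1 `^ t * b i `^ t)).
  move=> ir; have ai := a0 _ ir; have bi := b0 _ ir.
  have -> : a i + b i = (A + B) * (u * (A^-1 * a i) + v * (B^-1 * b i)).
    by rewrite /u /v; field; rewrite !gt_eqF.
  have iA : 0 <= A^-1 by rewrite invr_ge0 ltW.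
  have iB : 0 <= B^-1 by rewrite invr_ge0 ltW.
  have Ai : 0 <= A^-1 * a i by rewrite mulr_ge0.
  have Bi : 0 <= B^-1 * b i by rewrite mulr_ge0.
  rewrite (powRM _ (ltW AB0)); last by apply: addr_ge0; exact: mulr_ge0.
  rewrite ler_wpM2l ?powR_ge0// -!powRM//.
  exact: jensen_powR2.
rewrite big_seq; apply: (le_trans (ler_sum _ pt)).
rewrite -big_seq -mulr_sumr ler_piMr ?powR_ge0// big_split/= -!mulr_sumr -uv1.
have inv_le (C S : R) : 0 < C -> S <= C `^ t -> C^-1 `^ t * S <= 1.
  move=> C0 /(ler_wpM2l (powR_ge0 C^-1 t)) /le_trans; apply.
  by rewrite -powRM ?invr_ge0 ?(ltW C0)// mulVf ?gt_eqF// powR1.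
by rewrite lerD// ler_piMr// inv_le.
Qed.

Lemma lnorm0 q r : (1 <= q)%E -> lnorm q r (fun=> 0) = 0.
Proof.
move=> q1; apply/eqP; rewrite eq_le lnorm_ge0 andbT.
by rewrite -[leRHS](mul0r (lnorm q r (fun=> 0))) -lnormZ// ler_lnorm// => i _;
  rewrite mul0r lexx.
Qed.

Lemma lnormD q r a b : (1 <= q)%E ->
  (forall i, i \in r -> 0 <= a i) -> (forall i, i \in r -> 0 <= b i) ->
  lnorm q r (fun i => a i + b i) <= lnorm q r a + lnorm q r b.
Proof.
move=> q1 a0 b0; apply/ler_addgt0Pr => e e0.
have -> : lnorm q r a + lnorm q r b + e
    = (lnorm q r a + e / 2) + (lnorm q r b + e / 2) by lra.
have e20 : 0 < e / 2 by rewrite divr_gt0.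
by apply: lnormD_le; rewrite // ?ltr_wpDl ?lnorm_ge0// lerDl ltW.
Qed.

Lemma lnorm_sum q r n (a : nat -> I -> R) : (1 <= q)%E ->
  (forall j i, i \in r -> 0 <= a j i) ->
  lnorm q r (fun i => \sum_(j < n) a j i) <= \sum_(j < n) lnorm q r (a j).
Proof.
move=> q1 a0; elim: n => [|n IH].
  rewrite big_ord0 (_ : (fun i => _) = (fun=> 0)) ?lnorm0//.
  by apply/funext => i; rewrite big_ord0.
rewrite big_ord_recr/= (_ : (fun i => _) = (fun i => \sum_(j < n) a j i + a n i)).
  apply: le_trans (lnormD _ _ _) (lerD IH _) => // i ir; last exact: a0.
  by rewrite sumr_ge0// => j _; exact: a0.
by apply/funext => i; rewrite big_ord_recr.
Qed.

(** An error [e] in every entry adds at most [e] times the norm of the constant 1, which is finite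
    on a finite list. *)
Lemma lnorm_approx q r a M : (1 <= q)%E -> (forall i, i \in r -> 0 <= a i) ->
  (forall e, 0 < e -> exists2 b : I -> R,
     (forall i, i \in r -> 0 <= b i) /\ lnorm q r b <= M &
     forall i, i \in r -> a i <= b i + e) ->
  lnorm q r a <= M.
Proof.
move=> q1 a0 h; apply/ler_addgt0Pr => e e0.
(* The added 1 keeps the divisor positive even for an empty list. *)
pose L := lnorm q r (fun=> 1) + 1.
have L0 : 0 < L by rewrite ltr_wpDl ?lnorm_ge0.
have [b [b0 bM] ab] := h _ (divr_gt0 e0 L0).
have le0 : 0 <= e / L by rewrite divr_ge0// ltW.
apply: (@le_trans _ _ (lnorm q r (fun i => b i + e / L * 1))).
  by apply: ler_lnorm => // i ir; rewrite mulr1 ab// a0.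
apply: le_trans (lnormD _ _ _) _ => //; first by move=> *; rewrite mulr1.
rewrite lnormZ// lerD//.
by rewrite mulrAC ler_pdivrMr// ler_wpM2l ?ltW// /L ltrDl.
Qed.

End lnorm.

(** The shifted list only loses its first [j] entries. This lets the contributions of the levels
    [k + j] be estimated with [j] fixed and [k] varying. *)
Lemma lnorm_iota_shift {R : realType} (q : \bar R) (K j : nat) (a : nat -> R) :
  (1 <= q)%E -> (forall i, 0 <= a i) ->
  lnorm q (iota 0 K) (fun k => a (k + j)%N) <= lnorm q (iota 0 (K + j)) a.
Proof.
move=> q1 a0.
case: q q1 => [t t1|_|//]; last first.
  apply/lnorm_infty_leP => // [|i]; first exact: lnorm_ge0.
  rewrite mem_iota => /andP[_ iK]; apply: le_bigmax_seq => //.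
  by rewrite mem_iota add0n ltn_add2r.
have t0 : 0 < t by rewrite (lt_le_trans ltr01).
apply: ler_powRl; rewrite ?invr_ge0 ?(ltW t0)//.
  by rewrite sumr_ge0// => *; exact: powR_ge0.
rewrite addnC iotaD big_cat/= add0n.
rewrite (_ : \sum_(i <- iota 0 K) _ = \sum_(i <- iota j K) a i `^ t).
  by rewrite lerDr sumr_ge0// => *; exact: powR_ge0.
rewrite -[in RHS](addn0 j) iotaDl big_map.
by apply: eq_bigr => i _; rewrite addnC.
Qed.

(** * L^p norms of complex functions *)

Section modulus.
Context {R : rcfType}.
Implicit Types (x y : R[i]) (a : R).

Lemma normc_ge0 x : 0 <= nc x.
Proof. by case: x => a b; exact: sqrtr_ge0. Qed.

Lemma normcD_le x y : nc (x + y) <= nc x + nc y.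
Proof. exact: (@le_normcD R x y). Qed.

Lemma normc_opp x : nc (- x) = nc x.
Proof. exact: (@normcN R x). Qed.

Lemma normcB_le x y : nc (x - y) <= nc x + nc y.
Proof. by rewrite -(normc_opp y) normcD_le. Qed.

Lemma normc_real a : nc a%:C%C = `|a|.
Proof. by rewrite /= expr0n addr0 sqrtr_sqr. Qed.

Lemma normc_eq0 x : (nc x == 0) = (x == 0).
Proof.
by apply/eqP/eqP => [/Normc.eq0_normc//|->]; exact: Normc.normc0.
Qed.

Lemma normc_sum (I : Type) (r : seq I) (F : I -> R[i]) :
  nc (\sum_(i <- r) F i) <= \sum_(i <- r) nc (F i).
Proof.
elim/big_ind2: _ => // [|x a y b xa yb]; first by rewrite Normc.normc0.
by rewrite (le_trans (normcD_le _ _))// lerD.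
Qed.

Lemma Re_le_normc x : `|complex.Re x| <= nc x.
Proof.
case: x => a b /=; rewrite -sqrtr_sqr ler_wsqrtr// lerDl.
exact: sqr_ge0.
Qed.

Lemma Im_le_normc x : `|complex.Im x| <= nc x.
Proof.
case: x => a b /=; rewrite -sqrtr_sqr ler_wsqrtr// lerDr.
exact: sqr_ge0.
Qed.

Lemma normc_le_ReIm x : nc x <= `|complex.Re x| + `|complex.Im x|.
Proof.
case: x => a b; have -> : (a +i* b)%C = a%:C%C + (0 +i* b)%C.
  by apply/eqP; rewrite eq_complex /= addr0 add0r !eqxx.
apply: le_trans (normcD_le _ _) _; rewrite normc_real /= expr0n add0r sqrtr_sqr.
by rewrite addr0 add0r.
Qed.

(** The left side is the real part of the conjugate of [x] times [y]. *)
Lemma Re_Im_dot_le x y :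
  complex.Re x * complex.Re y + complex.Im x * complex.Im y <= nc x * nc y.
Proof.
have := Re_le_normc ((complex.Re x +i* - complex.Im x)%C * y).
rewrite Normc.normcM => /(le_trans (ler_norm _)).
case: x y => [a b] [c d] /=; rewrite sqrrN; apply: le_trans.
by rewrite mulNr opprK.
Qed.

Lemma sqr_normc_ReIm x : nc x ^+ 2 = complex.Re x ^+ 2 + complex.Im x ^+ 2.
Proof. by case: x => a b /=; rewrite sqr_sqrtr// addr_ge0// sqr_ge0. Qed.

End modulus.

Section cmeasurable_facts.
Context {d : measure_display} {T : measurableType d} {R : realType}.
Implicit Types (f g : T -> R[i]).

Lemma cmeasurableD f g : cmeasurable f -> cmeasurable g ->
  cmeasurable (fun x => f x + g x).
Proof.
move=> [f1 f2] [g1 g2]; split.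
  rewrite (_ : (fun x => _) = (fun x => complex.Re (f x) + complex.Re (g x))).
    exact: measurable_funD.
  by apply/funext => x; rewrite raddfD.
rewrite (_ : (fun x => _) = (fun x => complex.Im (f x) + complex.Im (g x))).
  exact: measurable_funD.
by apply/funext => x; rewrite raddfD.
Qed.

Lemma cmeasurableM f g : cmeasurable f -> cmeasurable g ->
  cmeasurable (fun x => f x * g x).
Proof.
move=> [f1 f2] [g1 g2]; split.
  rewrite (_ : (fun x => _) = (fun x => complex.Re (f x) * complex.Re (g x)
     - complex.Im (f x) * complex.Im (g x))).
    by apply: measurable_funB; exact: measurable_funM.
  by apply/funext => x; case: (f x) (g x) => [a b] [a' b'].
rewrite (_ : (fun x => _) = (fun x => complex.Re (f x) * complex.Im (g x)
     + complex.Im (f x) * complex.Re (g x))).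
  by apply: measurable_funD; exact: measurable_funM.
by apply/funext => x; case: (f x) (g x) => [a b] [a' b'].
Qed.

Lemma cmeasurable_cst (c : R[i]) : cmeasurable (fun _ : T => c).
Proof. by split; exact: measurable_cst. Qed.

Lemma cmeasurableN f : cmeasurable f -> cmeasurable (fun x => - f x).
Proof.
move=> mf; rewrite (_ : (fun x => _) = (fun x => (- 1) * f x)).
  exact: cmeasurableM (cmeasurable_cst _) mf.
by apply/funext => x; rewrite mulN1r.
Qed.

Lemma cmeasurableB f g : cmeasurable f -> cmeasurable g ->
  cmeasurable (fun x => f x - g x).
Proof. by move=> mf mg; apply: cmeasurableD mf (cmeasurableN mg). Qed.

Lemma cmeasurable_sum (I : Type) (r : seq I) (F : I -> T -> R[i]) :
  (forall i, cmeasurable (F i)) -> cmeasurable (fun x => \sum_(i <- r) F i x).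
Proof.
move=> mF; elim: r => [|i r IH].
  by under eq_fun do rewrite big_nil; exact: cmeasurable_cst.
by under eq_fun do rewrite big_cons; exact: cmeasurableD.
Qed.

Lemma cmeasurable_indic (A : set T) : measurable A ->
  cmeasurable (fun x => (\1_A x : R)%:C%C).
Proof. by move=> mA; split => /=; [exact: measurable_indic|exact: measurable_cst]. Qed.

Lemma measurable_normc f : cmeasurable f ->
  measurable_fun setT (fun x => nc (f x)).
Proof.
move=> [f1 f2].
rewrite (_ : (fun x => _) = (fun x : T =>
    (complex.Re (f x) ^+ 2 + complex.Im (f x) ^+ 2) `^ 2^-1)).
  apply: (measurableT_comp (measurable_powR _)).
  by apply: measurable_funD; exact: measurable_funX.
apply/funext => x; rewrite powR12_sqrt ?addr_ge0 ?sqr_ge0//.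
by case: (f x).
Qed.

End cmeasurable_facts.

Section cLnorm_facts.
Context {d : measure_display} {T : measurableType d} {R : realType}.
Variable m : {measure set T -> \bar R}.
Implicit Types (f g : T -> R[i]) (p : \bar R) (r M : R).

Lemma cLnorm_ge0 p f : (0 <= cLnorm m p f)%E.
Proof. exact: Lnorm_ge0. Qed.

Lemma cLnorm_finE r f :
  cLnorm m r%:E f = ((\int[m]_x (nc (f x) `^ r)%:E) `^ r^-1)%E.
Proof.
rewrite /cLnorm unlock; congr (_ `^ _)%E; apply: eq_integral => x _.
by rewrite /= ger0_norm ?normc_ge0.
Qed.

Lemma measurable_normc_powR r f : cmeasurable f ->
  measurable_fun setT (fun x => (nc (f x) `^ r)%:E).
Proof.
move=> /measurable_normc mf; apply/measurable_EFinP.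
exact: (measurableT_comp (measurable_powR _)).
Qed.

(** The L^oo norm is an essential supremum only if the space has positive measure. Otherwise it is
    0, and every property holds almost everywhere. *)
Lemma ae_normc_le f : cmeasurable f ->
  {ae m, forall x, ((nc (f x))%:E <= cLnorm m +oo%E f)%E}.
Proof.
move=> mf; rewrite /cLnorm unlock; case: ifPn => m0.
  apply: filterS (ess_sup_ge m _) => x /=; apply: le_trans.
  by rewrite /= lee_fin ler_norm.
exists setT; split => //.
by apply/eqP; rewrite eq_le measure_ge0 andbT leNgt.
Qed.

Lemma cLnorm_infty_leP f M : 0 <= M ->
  (cLnorm m +oo%E f <= M%:E)%E <-> {ae m, forall x, nc (f x) <= M}.
Proof.
move=> M0; rewrite /cLnorm unlock; case: ifPn => m0; last first.
  rewrite lee_fin M0; split => // _; exists setT; split => //.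
  by apply/eqP; rewrite eq_le measure_ge0 andbT leNgt.
split => [/ess_supP|h].
  by apply: filterS => x /=; rewrite lee_fin ger0_norm// normc_ge0.
by apply/ess_supP; apply: filterS h => x /=; rewrite lee_fin ger0_norm// normc_ge0.
Qed.

Lemma le_cLnorm p f g : (1 <= p)%E -> cmeasurable f -> cmeasurable g ->
  {ae m, forall x, nc (f x) <= nc (g x)} -> (cLnorm m p f <= cLnorm m p g)%E.
Proof.
case: p => [r r1|_|//] mf mg fg.
  have r0 : 0 < r by rewrite (lt_le_trans ltr01).
  rewrite !cLnorm_finE; apply: gt0_ler_poweR.
  - by rewrite invr_ge0 ltW.
  - by rewrite in_itv/= integral_ge0 ?leey// => x _; rewrite lee_fin powR_ge0.
  - by rewrite in_itv/= integral_ge0 ?leey// => x _; rewrite lee_fin powR_ge0.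
  apply: ae_ge0_le_integral => //; do ?exact: measurable_normc_powR;
    try by move=> x _; rewrite lee_fin powR_ge0.
  apply: filterS fg => x fg _; rewrite lee_fin ler_powRl ?normc_ge0//.
  exact: ltW.
rewrite /cLnorm unlock; case: ifPn => // m0.
apply: le_ess_sup; apply: filterS fg => x fg.
by rewrite /= lee_fin !ger0_norm ?normc_ge0.
Qed.

Lemma cLnorm_ae_eq p f g : (1 <= p)%E -> cmeasurable f -> cmeasurable g ->
  ae_eq m setT f g -> cLnorm m p f = cLnorm m p g.
Proof.
move=> p1 mf mg fg; apply/eqP; rewrite eq_le; apply/andP; split;
  apply: le_cLnorm => //; apply: filterS fg => x /(_ I) ->; exact: lexx.
Qed.

Lemma cLnormD p f g : (1 <= p)%E -> cmeasurable f -> cmeasurable g ->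
  (cLnorm m p (fun x => f x + g x)%R <= cLnorm m p f + cLnorm m p g)%E.
Proof.
move=> p1 mf mg.
have := eminkowski m (measurable_normc mf) (measurable_normc mg) p1.
apply: le_trans.
(* The real function |f| + |g| is read as a complex one, so that monotonicity of the complex norm
   reduces the claim to the real Minkowski inequality. *)
have h : cmeasurable (fun x => (nc (f x) + nc (g x))%:C%C).
  split; last exact: measurable_cst.
  by apply: measurable_funD; exact: measurable_normc.
have := le_cLnorm p1 (cmeasurableD mf mg) h; rewrite {2}/cLnorm.
rewrite (_ : (fun x : T => (nc _%:C%C)%:E) = 
  EFin \o ((fun x => nc (f x)) \+ (fun x => nc (g x)))%R).
  apply; apply: nearW => x; rewrite normc_real ger0_norm ?addr_ge0 ?normc_ge0//.
  exact: normcD_le.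
by apply/funext => x; rewrite normc_real ger0_norm// addr_ge0 ?normc_ge0.
Qed.

Lemma cLnormM_le p f g M : (1 <= p)%E -> cmeasurable f -> cmeasurable g ->
  0 <= M -> {ae m, forall x, nc (f x) <= M} ->
  (cLnorm m p (fun x => f x * g x)%R <= M%:E * cLnorm m p g)%E.
Proof.
move=> p1 mf mg M0 fM.
(* Domination by [M * g] leaves only homogeneity for a real factor; general homogeneity is deduced
   from the present lemma. *)
suff <- : cLnorm m p (fun x => M%:C%C * g x) = (M%:E * cLnorm m p g)%E.
  apply: le_cLnorm => //; first exact: cmeasurableM.
    exact: cmeasurableM (cmeasurable_cst _) mg.
  apply: filterS fM => x fM.
  by rewrite !Normc.normcM normc_real ger0_norm// ler_wpM2r ?normc_ge0.
case: p p1 => [r r1|_|//].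
  have r0 : 0 < r by rewrite (lt_le_trans ltr01).
  rewrite !cLnorm_finE.
  rewrite (_ : (fun x => _) = (fun x => (M `^ r)%:E * (nc (g x) `^ r)%:E)%E).
    rewrite ge0_integralZl_EFin ?powR_ge0//; last 2 first.
    - by move=> x _; rewrite lee_fin powR_ge0.
    - exact: measurable_normc_powR.
    rewrite poweRM ?lee_fin ?powR_ge0//; last first.
      by apply: integral_ge0 => x _; rewrite lee_fin powR_ge0.
    by rewrite poweR_EFin powRK// gt_eqF.
  apply/funext => x; rewrite -EFinM -powRM ?normc_ge0//.
  by rewrite Normc.normcM normc_real ger0_norm.
rewrite /cLnorm unlock; case: ifPn => m0; last by rewrite mule0.
rewrite -ess_supZl//; congr ess_sup; apply/funext => x /=.
have := Normc.normcM M%:C%C (g x); rewrite normc_real (ger0_norm M0) => -> .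
by rewrite normrM (ger0_norm M0).
Qed.

(** The lower bound is the upper bound for the factor [c^-1] and the function [c * f]. *)
Lemma cLnormZ p f (c : R[i]) : (1 <= p)%E -> cmeasurable f ->
  cLnorm m p (fun x => c * f x) = ((nc c)%:E * cLnorm m p f)%E.
Proof.
move=> p1 mf; apply/eqP; rewrite eq_le; apply/andP; split.
  apply: (cLnormM_le p1 (cmeasurable_cst c) mf (normc_ge0 c)).
  by apply: nearW => x; exact: lexx.
have [->|c0] := eqVneq c 0; first by rewrite Normc.normc0 mul0e cLnorm_ge0.
have nc0 : 0 < nc c by rewrite lt_def normc_eq0 c0 normc_ge0.
have mcf : cmeasurable (fun x => c * f x) by exact: cmeasurableM (cmeasurable_cst _) mf.
rewrite -lee_pdivlMl//; have ic0 : 0 <= (nc c)^-1 by rewrite invr_ge0 ltW.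
apply: le_trans (cLnormM_le p1 (cmeasurable_cst c^-1) mcf ic0 _); last first.
  by apply: nearW => x; rewrite Normc.normcV.
by rewrite (_ : (fun x => _) = f)//; apply/funext => x; rewrite mulKf.
Qed.

Lemma cLnormN p f : (1 <= p)%E -> cmeasurable f ->
  cLnorm m p (fun x => - f x) = cLnorm m p f.
Proof. by move=> p1 mf; rewrite /cLnorm; under eq_fun do rewrite normc_opp. Qed.

Lemma cLnormB p f g : (1 <= p)%E -> cmeasurable f -> cmeasurable g ->
  (cLnorm m p (fun x => f x - g x)%R <= cLnorm m p f + cLnorm m p g)%E.
Proof.
move=> p1 mf mg; rewrite -(cLnormN p1 mg); apply: cLnormD => //.
exact: cmeasurableN.
Qed.

Lemma cLnorm0 p : (1 <= p)%E -> cLnorm m p (fun=> 0) = 0%E.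
Proof.
move=> p1; transitivity (cLnorm m p (fun x : T => (0 * (1 : R[i]))%R)).
  by under [in RHS]eq_fun do rewrite mul0r.
by rewrite cLnormZ ?Normc.normc0 ?mul0e//; exact: cmeasurable_cst.
Qed.

End cLnorm_facts.

(** * Averages *)

Section averages.
Context {d : measure_display} {T : measurableType d} {R : realType}.
Variable m : {finite_measure set T -> \bar R}.
Implicit Types (f g : T -> R[i]) (Q : set T) (r M : R).

Lemma integrableZl_EFin Q (k : R) (h : T -> R) : measurable Q ->
  m.-integrable Q (EFin \o h) -> m.-integrable Q (EFin \o (fun x => k * h x)).
Proof. by move=> mQ /(integrableZl mQ k); apply: eq_integrable. Qed.

Lemma integrableD_EFin Q (h h' : T -> R) : measurable Q ->
  m.-integrable Q (EFin \o h) -> m.-integrable Q (EFin \o h') ->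
  m.-integrable Q (EFin \o (fun x => h x + h' x)).
Proof. by move=> mQ ih /(integrableD mQ ih); apply: eq_integrable. Qed.

Definition cL1 f : Prop :=
  cmeasurable f /\ m.-integrable setT (EFin \o (fun x => nc (f x))).

Lemma cLnorm_fin_leP r f M : 0 < r -> 0 <= M ->
  (cLnorm m r%:E f <= M%:E)%E <-> ((\int[m]_x (nc (f x) `^ r)%:E) <= (M `^ r)%:E)%E.
Proof.
move=> r0 M0; rewrite cLnorm_finE.
have i0 : (0 <= \int[m]_x (nc (f x) `^ r)%:E)%E.
  by apply: integral_ge0 => x _; rewrite lee_fin powR_ge0.
have : ((\int[m]_x (nc (f x) `^ r)%:E)%E = +oo%E) \/
  exists2 y : R, 0 <= y & (\int[m]_x (nc (f x) `^ r)%:E)%E = y%:E.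
  move: i0; case: (\int[m]_x _)%E => [y|_|//]; last by left.
  by rewrite lee_fin; right; exists y.
move=> [->|[y y0 ->]].
  by rewrite poweRyr ?invr_neq0 ?gt_eqF.
by rewrite poweR_EFin !lee_fin powRV_le.
Qed.

Lemma cLp_int_lty r f : 0 < r -> cLp m r%:E f ->
  ((\int[m]_x (nc (f x) `^ r)%:E) < +oo)%E.
Proof.
move=> r0 [_]; rewrite cLnorm_finE; apply: lty_poweRy.
by rewrite invr_neq0 ?gt_eqF.
Qed.

Lemma integrable_normc_powR r f : 0 < r -> cLp m r%:E f ->
  m.-integrable setT (EFin \o (fun x => nc (f x) `^ r)).
Proof.
move=> r0 h; have [mf _] := h; apply/integrableP; split.
  exact: measurable_normc_powR.
apply: le_lt_trans (cLp_int_lty r0 h).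
by under eq_integral => x _ do rewrite /= ger0_norm ?powR_ge0//.
Qed.

(** The tangent line at 1 gives |f| <= |f|^r + 1, and constants are integrable for a finite
    measure. *)
Lemma cLp_cL1 r f : 1 <= r -> cLp m r%:E f -> cL1 f.
Proof.
move=> r1 h; have [mf _] := h; have r0 : 0 < r by rewrite (lt_le_trans ltr01).
split => //.
have h1 : m.-integrable setT
    ((EFin \o (fun x => nc (f x) `^ r)%R) \+ (EFin \o cst 1%R))%E.
  apply: integrableD => //; first exact: integrable_normc_powR.
  exact: finite_measure_integrable_cst.
apply: le_integrable h1 => //.
  by apply/measurable_EFinP; exact: measurable_normc.
move=> x _ /=; rewrite lee_fin !ger0_norm ?normc_ge0 ?addr_ge0 ?powR_ge0//.
have := powR_tangent r1 ler01 (normc_ge0 (f x)).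
rewrite powR1 mul1r => /le_trans; apply; rewrite mulr1 lerD//.
  by rewrite ler_piMl ?powR_ge0// invf_le1.
by rewrite gerBl invr_ge0 ltW.
Qed.

Section integrability.
Variables (f : T -> R[i]) (hf : cL1 f) (Q : set T) (mQ : measurable Q).

Lemma cL1_integrable : m.-integrable Q (EFin \o (fun x => nc (f x))).
Proof. by apply: integrableS hf.2. Qed.

Lemma cL1_integrable_Re : m.-integrable Q (EFin \o (fun x => complex.Re (f x))).
Proof.
apply: le_integrable cL1_integrable => //.
  by apply/measurable_EFinP; apply: measurable_funS hf.1.1.
by move=> x _ /=; rewrite lee_fin (ger0_norm (normc_ge0 _)) Re_le_normc.
Qed.

Lemma cL1_integrable_Im : m.-integrable Q (EFin \o (fun x => complex.Im (f x))).
Proof.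
apply: le_integrable cL1_integrable => //.
  by apply/measurable_EFinP; apply: measurable_funS hf.1.2.
by move=> x _ /=; rewrite lee_fin (ger0_norm (normc_ge0 _)) Im_le_normc.
Qed.

End integrability.

Definition cint f Q : R[i] :=
  ((\int[m]_(x in Q) complex.Re (f x)) +i* (\int[m]_(x in Q) complex.Im (f x)))%C.

(* Since 0^-1 = 0, the average over [set0] is 0; [set0] plays the role of the
   parent of the root, so that the root needs no separate treatment. *)
Definition avg f Q : R[i] := ((vol m Q)^-1)%:C%C * cint f Q.

Lemma avg_set0 f : avg f set0 = 0.
Proof.
rewrite /avg /cint !Rintegral_set0 (_ : (0 +i* 0)%C = 0 :> R[i]) ?mulr0//.
Qed.

Lemma avgD f g Q : cL1 f -> cL1 g -> measurable Q ->
  avg (fun x => f x + g x) Q = avg f Q + avg g Q.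
Proof.
move=> hf hg mQ; rewrite /avg -mulrDr; congr (_ * _); rewrite /cint.
rewrite (_ : (fun x => complex.Re (f x + g x)) =
  (fun x => complex.Re (f x) + complex.Re (g x))); last first.
  by apply/funext => x; rewrite raddfD.
rewrite (_ : (fun x => complex.Im (f x + g x)) =
  (fun x => complex.Im (f x) + complex.Im (g x))); last first.
  by apply/funext => x; rewrite raddfD.
by rewrite !RintegralD//; first [exact: cL1_integrable_Re|exact: cL1_integrable_Im].
Qed.

(** With [z] the integral, |z|^2 is the integral of the real part of the conjugate of [z] times [f],
    which is at most |z| |f| pointwise; then |z| is cancelled. *)
Lemma normc_cint_le f Q : cL1 f -> measurable Q ->
  nc (cint f Q) <= \int[m]_(x in Q) nc (f x).
Proof.
move=> hf mQ; set z := cint f Q.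
have [->|z0] := eqVneq z 0.
  by rewrite Normc.normc0 Rintegral_ge0// => x _; exact: normc_ge0.
have nz : 0 < nc z by rewrite lt_def normc_eq0 z0 normc_ge0.
rewrite -(ler_pM2l nz) -expr2 sqr_normc_ReIm.
have iRe := cL1_integrable_Re hf mQ; have iIm := cL1_integrable_Im hf mQ.
have -> : complex.Re z ^+ 2 + complex.Im z ^+ 2 =
    \int[m]_(x in Q) (complex.Re z * complex.Re (f x) + complex.Im z * complex.Im (f x)).
  by rewrite RintegralD ?RintegralZl//; exact: integrableZl_EFin.
rewrite -RintegralZl//; last exact: cL1_integrable.
apply: le_Rintegral => //.
- by apply: (integrableD_EFin mQ); exact: integrableZl_EFin.
- by apply: integrableZl_EFin => //; exact: cL1_integrable.
- by move=> x _; exact: Re_Im_dot_le.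
Qed.

Section positive_volume.
Variables (Q : set T) (mQ : measurable Q) (Q0 : 0 < vol m Q).

Lemma normc_avg_le f : cL1 f ->
  vol m Q * nc (avg f Q) <= \int[m]_(x in Q) nc (f x).
Proof.
move=> hf; rewrite /avg Normc.normcM normc_real ger0_norm ?invr_ge0 ?(ltW Q0)//.
by rewrite mulrA divff ?gt_eqF// mul1r normc_cint_le.
Qed.

(* Jensen's inequality, by integrating the tangent line at [nc (avg f Q)]. *)
Lemma avg_jensen r f : 1 <= r -> cLp m r%:E f ->
  ((vol m Q * nc (avg f Q) `^ r)%:E <= \int[m]_(x in Q) (nc (f x) `^ r)%:E)%E.
Proof.
move=> r1 hf; have r0 : 0 < r by rewrite (lt_le_trans ltr01).
have h1 := cLp_cL1 r1 hf.
have ip : m.-integrable Q (EFin \o (fun x => nc (f x) `^ r)).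
  by apply: integrableS (integrable_normc_powR r0 hf).
rewrite -(fineK (integrable_fin_num mQ ip)) lee_fin -/(Rintegral m Q _).
set y := nc (avg f Q); have y0 : 0 <= y by exact: normc_ge0.
have A := ler_wpM2l (powR_ge0 y (r - 1)) (normc_avg_le h1).
have B : \int[m]_(x in Q) (y `^ (r - 1) * nc (f x)) <=
    \int[m]_(x in Q) (r^-1 * nc (f x) `^ r + (1 - r^-1) * y `^ r).
  apply: le_Rintegral => //.
  - by apply: integrableZl_EFin => //; exact: cL1_integrable.
  - apply: (integrableD_EFin mQ); first exact: integrableZl_EFin.
    exact: finite_measure_integrable_cst.
  - by move=> x _; apply: powR_tangent => //; exact: normc_ge0.
move: B; rewrite RintegralZl//; last exact: cL1_integrable.
rewrite RintegralD//; [|exact: integrableZl_EFin|exact: finite_measure_integrable_cst].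
rewrite RintegralZl// Rintegral_cst// => B.
have := le_trans A B; rewrite -/y mulrCA -(mulrC y) mulr_powRB1//.
rewrite -/(vol m Q) => C.
have : r^-1 * (vol m Q * y `^ r) <= r^-1 * \int[m]_(x in Q) (nc (f x) `^ r).
  by move: C; set I := \int[m]_(x in Q) _; lra.
by rewrite ler_pM2l ?invr_gt0.
Qed.

Lemma normc_avg_bounded f M : cL1 f -> 0 <= M ->
  {ae m, forall x, nc (f x) <= M} -> nc (avg f Q) <= M.
Proof.
move=> hf M0 fM; rewrite -(ler_pM2l Q0); apply: (le_trans (normc_avg_le hf)).
rewrite mulrC -(Rintegral_cst m)// -lee_fin /Rintegral !fineK; last 2 first.
- exact: (integrable_fin_num mQ (finite_measure_integrable_cst _ _ mQ)).
- exact: (integrable_fin_num mQ (cL1_integrable hf mQ)).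
apply: ae_ge0_le_integral => //.
- by move=> x _; rewrite lee_fin normc_ge0.
- by have /integrableP[] := cL1_integrable hf mQ.
- by apply: filterS fM => x; rewrite lee_fin.
Qed.

Lemma avg_cst_on f v : cL1 f -> (forall x, Q x -> f x = v) -> avg f Q = v.
Proof.
move=> hf fv; rewrite /avg /cint.
rewrite (@eq_Rintegral _ _ _ m Q (fun=> complex.Re v));
  last by move=> x /[1!inE] /fv ->.
rewrite [X in (_ +i* X)%C](@eq_Rintegral _ _ _ m Q (fun=> complex.Im v));
  last by move=> x /[1!inE] /fv ->.
rewrite !Rintegral_cst// -/(vol m Q); case: v {fv} => a b.
apply/eqP; rewrite eq_complex /=.
have V0 : vol m Q != 0 by rewrite gt_eqF.
by rewrite !mul0r subr0 addr0 ![_^-1 * _]mulrC !mulfK ?eqxx.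
Qed.

End positive_volume.

End averages.

(** * Cells of a good grid *)

Section grid.
Context {d : measure_display} {T : measurableType d} {R : realType}.
Variable m : {finite_measure set T -> \bar R}.
Variables (l1 l2 : R) (P : nat -> set (set T)).
Hypothesis hP : good_grid m l1 l2 P.
Implicit Types (Q J : set T) (v : set T -> R[i]) (i j k : nat) (x : T).

Lemma l1_gt0 : 0 < l1. Proof. by have [] := gg_lambda hP. Qed.

Lemma l2_gt0 : 0 < l2.
Proof. by have [l10 [l12 _]] := gg_lambda hP; exact: lt_trans l12. Qed.

Lemma l2_lt1 : l2 < 1. Proof. by have [_ []] := gg_lambda hP. Qed.

Definition cells k : seq (set T) := finmap.enum_fset (fset_set (P k)).

Lemma mem_cells k Q : (Q \in cells k) = `[< P k Q >].
Proof.
apply/idP/asboolP => [|PQ].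
  by rewrite /cells in_fset_set ?inE//; exact: gg_finite hP k.
by rewrite /cells in_fset_set ?inE//; exact: gg_finite hP k.
Qed.

Lemma cells_P k Q : Q \in cells k -> P k Q.
Proof. by rewrite mem_cells => /asboolP. Qed.

Lemma P_cells k Q : P k Q -> Q \in cells k.
Proof. by rewrite mem_cells => ?; exact/asboolP. Qed.

Lemma cells_uniq k : uniq (cells k).
Proof. exact: finmap.fset_uniq. Qed.

Lemma volE Q : measurable Q -> (vol m Q)%:E = m Q.
Proof. by move=> mQ; rewrite fineK// fin_num_measure. Qed.

Lemma vol_ge0 Q : 0 <= vol m Q. Proof. exact: fine_ge0. Qed.

Lemma le_vol Q J : measurable Q -> measurable J -> Q `<=` J -> vol m Q <= vol m J.
Proof. by move=> mQ mJ QJ; rewrite -lee_fin !volE// le_measure// inE. Qed.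

Lemma cell_vol_gt0 k Q : P k Q -> 0 < vol m Q.
Proof.
by move=> PQ; rewrite -lte_fin volE ?(gg_pos hP PQ)//; exact: gg_measurable hP _ _ PQ.
Qed.

Lemma cell_neq0 k Q : P k Q -> exists x, Q x.
Proof.
move=> PQ; apply/set0P/eqP => Q0; have := gg_pos hP PQ.
by rewrite Q0 measure0 ltxx.
Qed.

Lemma cell_eq k Q J x : P k Q -> P k J -> Q x -> J x -> Q = J.
Proof.
by move=> PQ PJ Qx Jx; apply: (gg_disjoint hP PQ PJ); exists x.
Qed.

Lemma child_vol k Q J : P k.+1 Q -> P k J -> Q `<=` J ->
  l1 * vol m J <= vol m Q <= l2 * vol m J.
Proof.
move=> PQ PJ QJ; have := gg_ratio hP PQ PJ QJ.
by rewrite ler_pdivlMr ?ler_pdivrMr ?(cell_vol_gt0 PJ).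
Qed.

Lemma ancestor k n J : P (k + n)%N J ->
  exists Q, [/\ P k Q, J `<=` Q & vol m J <= l2 ^+ n * vol m Q].
Proof.
elim: n J => [|n IH] J; first by rewrite addn0 => PJ; exists J; rewrite expr0 mul1r; split.
rewrite addnS => PJ; have [J' PJ' JJ'] := gg_nested hP PJ.
have [Q [PQ J'Q vQ]] := IH _ PJ'; exists Q; split => //.
  exact: subset_trans J'Q.
have /andP[_ /le_trans] := child_vol PJ PJ' JJ'; apply.
by rewrite exprS -mulrA ler_wpM2l// ltW// l2_gt0.
Qed.

(** The ancestor of [J] at level [k] shares the point [x] with [Q], so disjointness of the level
    makes it equal to [Q]. *)
Lemma cell_nested k i Q J x : (k <= i)%N -> P k Q -> P i J -> Q x -> J x ->
  J `<=` Q /\ vol m J <= l2 ^+ (i - k) * vol m Q.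
Proof.
move=> ki PQ; rewrite -{1}(subnKC ki) => PJ Qx Jx.
have [Q' [PQ' JQ' vJ]] := ancestor PJ.
by rewrite (cell_eq PQ PQ' Qx (JQ' _ Jx)).
Qed.

(** A cell that reappeared at a deeper level would have a volume strictly smaller than its own.
    Hence the set alone determines its level, and [parent] can be a function of the set. *)
Lemma level_uniq k i Q : P k Q -> P i Q -> k = i.
Proof.
wlog ki : k i / (k <= i)%N.
  by move=> h; case: (leqP k i) => [/h//|/ltnW /h h' ? ?]; apply/esym/h'.
move=> PQ PQ'; have [x Qx] := cell_neq0 PQ.
have [_] := cell_nested ki PQ PQ' Qx Qx.
rewrite -{1}[vol m Q]mul1r ler_pM2r ?(cell_vol_gt0 PQ)// => h.
apply/eqP; rewrite eqn_leq ki -subn_eq0 /=; apply/eqP.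
case E : (i - k)%N h => [//|n]; rewrite leNgt.
by rewrite exprn_ilt1 ?l2_lt1// ltW// l2_gt0.
Qed.

Definition parent Q : set T :=
  xget set0 [set J | exists k, [/\ P k.+1 Q, P k J & Q `<=` J]].

Lemma parentP k Q : P k.+1 Q -> P k (parent Q) /\ Q `<=` parent Q.
Proof.
move=> PQ; rewrite /parent; case: xgetP => [J _ [k' [PQ' PJ QJ]]|h].
  by have [->] := level_uniq PQ PQ'.
have [J PJ QJ] := gg_nested hP PQ.
by case: (h J); exists k.
Qed.

Lemma parent_root : parent setT = set0.
Proof.
rewrite /parent; case: xgetP => [J _ [k [PT _ _]]|//].
have PT0 : P 0%N setT by rewrite (gg_root hP).
by have := level_uniq PT PT0.
Qed.

(** Both E_k f, with [v := avg m f], and the levels of a representation, with [v := coef m s p c],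
    have this form. *)
Definition step k v x : R[i] := \sum_(Q <- cells k) v Q * (\1_Q x : R)%:C%C.

Lemma stepE k v Q x : P k Q -> Q x -> step k v x = v Q.
Proof.
move=> PQ Qx; rewrite /step (bigD1_seq Q) ?P_cells ?cells_uniq//=.
rewrite indicE mem_set// mulr1 big1_seq ?addr0// => J /andP[JQ /cells_P PJ].
rewrite indicE memNset ?mulr0// => Jx.
by rewrite (cell_eq PQ PJ Qx Jx) eqxx in JQ.
Qed.

Lemma step_out k v x : ~ (\bigcup_(Q in P k) Q) x -> step k v x = 0.
Proof.
move=> nx; rewrite /step big_seq big1// => Q /cells_P PQ.
by rewrite indicE memNset ?mulr0// => Qx; apply: nx; exists Q.
Qed.

Lemma cells_measurable k Q : Q \in cells k -> measurable Q.
Proof. by move=> /cells_P; exact: gg_measurable hP _ _. Qed.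

Lemma cmeasurable_step k v : cmeasurable (step k v).
Proof.
rewrite /step; under eq_fun do rewrite big_seq.
(* Summands are made 0 off the list because [cmeasurable_sum] asks for measurability at every
   index. *)
have -> : (fun x => \sum_(Q <- cells k | Q \in cells k) v Q * (\1_Q x : R)%:C%C) =
  (fun x => \sum_(Q <- cells k) (if Q \in cells k then v Q * (\1_Q x : R)%:C%C else 0)).
  by apply/funext => x; rewrite big_mkcond.
apply: cmeasurable_sum => Q; case Qk : (Q \in cells k); last first.
  exact: cmeasurable_cst.
exact: cmeasurableM (cmeasurable_cst _) (cmeasurable_indic (cells_measurable Qk)).
Qed.

(* At most one cell of the level contains [x]. *)
Lemma step_powR k v (r : R) x : 0 < r ->
  nc (step k v x) `^ r = \sum_(Q <- cells k) nc (v Q) `^ r * \1_Q x.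
Proof.
move=> r0.
have [[Q PQ Qx]|nx] := pselect ((\bigcup_(Q in P k) Q) x).
  rewrite (stepE _ PQ Qx) (bigD1_seq Q) ?P_cells ?cells_uniq//=.
  rewrite indicE mem_set// mulr1 big1_seq ?addr0// => J /andP[JQ /cells_P PJ].
  rewrite indicE memNset ?mulr0// => Jx.
  by rewrite (cell_eq PQ PJ Qx Jx) eqxx in JQ.
rewrite step_out// Normc.normc0 powR0 ?gt_eqF// big_seq big1// => Q /cells_P PQ.
by rewrite indicE memNset ?mulr0// => Qx; apply: nx; exists Q.
Qed.

Lemma integral_step_powR k v (r : R) (A : set T) : 0 < r -> measurable A ->
  (\int[m]_(x in A) (nc (step k v x) `^ r)%:E)%E =
  (\sum_(Q <- cells k) nc (v Q) `^ r * vol m (Q `&` A))%:E.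
Proof.
move=> r0 mA.
rewrite (_ : (fun x => _) = (fun x : T => \sum_(Q <- cells k)
   (if Q \in cells k then (nc (v Q) `^ r)%:E * (\1_Q x)%:E else 0))%E); last first.
  apply/funext => x; rewrite step_powR// -sumEFin big_seq big_mkcond.
  by apply: eq_bigr => Q _; case: ifP.
rewrite ge0_integral_sum//; last 2 first.
- move=> Q; case Qk : (Q \in cells k); last exact: measurable_cst.
  have mQ := cells_measurable Qk; apply: emeasurable_funM; first exact: measurable_cst.
  by apply/measurable_EFinP; exact: measurable_indic.
- move=> Q x _; case: ifPn => // _.
  by rewrite mule_ge0// lee_fin ?powR_ge0// indicE ler0n.
rewrite -sumEFin; apply: eq_big_seq => Q Qk; rewrite Qk.
have mQ := cells_measurable Qk.
rewrite ge0_integralZl_EFin ?powR_ge0//.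
- by rewrite integral_indic// EFinM volE//; exact: measurableI.
- by apply/measurable_EFinP; exact: measurable_indic.
Qed.

Lemma levelE (c : set T -> R[i]) (a : set T -> T -> R[i]) k x :
  level P c a k x = \sum_(Q <- cells k) c Q * a Q x.
Proof. by rewrite /level fsbig_finite//; exact: gg_finite hP k. Qed.

Lemma level_sumE (p : R) (c : set T -> R[i]) k :
  level_sum P p c k = \sum_(Q <- cells k) nc (c Q) `^ p.
Proof. by rewrite /level_sum fsbig_finite//; exact: gg_finite hP k. Qed.

End grid.

(** * Costs and canonical atoms *)

Section ereal_sequences.
Context {R : realType}.
Implicit Types (u : nat -> \bar R).

Lemma cvge0P u : (forall n, 0 <= u n)%E ->
  u @ \oo --> 0%E <->
  forall e : R, 0 < e -> exists N : nat, forall n, (N <= n)%N -> (u n <= e%:E)%E.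
Proof.
move=> u0; split => [/fine_cvgP[ufin /cvgrPdist_le ucvg] e e0|h].
  have [N _ hN] : \forall n \near \oo, (u n <= e%:E)%E.
    near=> n.
    have un : u n \is a fin_num by near: n.
    have : `|0 - (fine \o u) n| <= e by near: n; exact: ucvg.
    rewrite sub0r normrN /= ger0_norm ?fine_ge0// => une.
    by rewrite -(fineK un) lee_fin.
  by exists N => n; exact: hN.
apply/fine_cvgP; split.
  have [N hN] := h 1 ltr01; exists N => // n /= /hN un.
  by rewrite ge0_fin_numE// (le_lt_trans un)// ltry.
apply/cvgrPdist_le => e e0; have [N hN] := h e e0; exists N => // n /= /hN un.
rewrite sub0r normrN ger0_norm ?fine_ge0// -lee_fin fineK//.
by rewrite ge0_fin_numE// (le_lt_trans un)// ltry.
Unshelve. all: by end_near. Qed.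

Lemma nneseries_leP u (M : \bar R) : (forall n, 0 <= u n)%E ->
  (\sum_(k <oo) u k <= M)%E <-> forall n, (\sum_(0 <= k < n) u k <= M)%E.
Proof.
move=> u0; split => [h n|h].
  by apply: le_trans h; apply: nneseries_lim_ge.
by apply: lime_le; [exact: is_cvg_nneseries|exact: nearW].
Qed.

Lemma sum_geometric_le (t : R) n : 0 <= t < 1 ->
  \sum_(j < n) t ^+ j <= (1 - t)^-1.
Proof.
move=> /andP[t0 t1]; have t1' : 0 < 1 - t by rewrite subr_gt0.
rewrite -[leRHS]mul1r ler_pdivlMr// mulrC.
have -> : (1 - t) * \sum_(j < n) t ^+ j = 1 - t ^+ n.
  by rewrite -opprB mulNr -subrX1 opprB.
by rewrite gerBl exprn_ge0.
Qed.

End ereal_sequences.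

Section representations.
Context {d : measure_display} {T : measurableType d} {R : realType}.
Variable m : {finite_measure set T -> \bar R}.
Variables (l1 l2 : R) (P : nat -> set (set T)).
Hypothesis hP : good_grid m l1 l2 P.
Variables (s p : R) (q : \bar R).
Hypotheses (hp : 1 <= p) (hq : (1 <= q)%E) (hs : 0 < s < p^-1).
Implicit Types (Q J : set T) (c : set T -> R[i]) (f g : T -> R[i]) (M : R).

Lemma p_gt0 : 0 < p. Proof. exact: lt_le_trans ltr01 hp. Qed.

Lemma s_gt0 : 0 < s. Proof. by case/andP: hs. Qed.

Lemma s_ltVp : s < p^-1. Proof. by case/andP: hs. Qed.

Local Notation cells := (cells P).

Definition level_norm c k : R := lnorm p%:E (cells k) (fun Q => nc (c Q)).

Lemma level_normE c k : level_norm c k = lnorm p%:E (cells k) (fun Q => nc (c Q)).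
Proof. by []. Qed.

(** The cost of the levels strictly below [K]. *)
Definition trunc_cost K c : R := lnorm q (iota 0 K) (level_norm c).

Lemma level_norm_ge0 c k : 0 <= level_norm c k. Proof. exact: lnorm_ge0. Qed.

Lemma lee1_EFin : (1 <= p%:E)%E. Proof. exact: hp. Qed.

Lemma le_level_norm c c' k : (forall Q, P k Q -> nc (c Q) <= nc (c' Q)) ->
  level_norm c k <= level_norm c' k.
Proof.
move=> cc'; apply: (ler_lnorm lee1_EFin) => Q /(cells_P hP) PQ.
by rewrite normc_ge0 cc'.
Qed.

Lemma le_trunc_cost c c' K : (forall k Q, P k Q -> nc (c Q) <= nc (c' Q)) ->
  trunc_cost K c <= trunc_cost K c'.
Proof.
move=> cc'; apply: ler_lnorm => // k _; rewrite level_norm_ge0 /=.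
by apply: le_level_norm; exact: cc'.
Qed.

Lemma level_normD_le c c1 c2 (A B : R) k : 0 <= A -> 0 <= B ->
  (forall Q, P k Q -> nc (c Q) <= A * nc (c1 Q) + B * nc (c2 Q)) ->
  level_norm c k <= A * level_norm c1 k + B * level_norm c2 k.
Proof.
move=> A0 B0 h; have n0 := @normc_ge0 R.
rewrite -!(lnormZ lee1_EFin)//.
apply: le_trans (lnormD lee1_EFin _ _); last 2 first.
- by move=> *; rewrite mulr_ge0.
- by move=> *; rewrite mulr_ge0.
apply: (ler_lnorm lee1_EFin) => Q /(cells_P hP) PQ.
by rewrite n0 h.
Qed.

(** This form serves sums ([A = B = 1]), scalar multiples ([A = |a|] and [B = 0]) and the Leibniz
    rule (sup norms of the factors). *)
Lemma trunc_costD_le c c1 c2 (A B : R) K : 0 <= A -> 0 <= B ->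
  (forall k Q, P k Q -> nc (c Q) <= A * nc (c1 Q) + B * nc (c2 Q)) ->
  trunc_cost K c <= A * trunc_cost K c1 + B * trunc_cost K c2.
Proof.
move=> A0 B0 h.
have s0 := level_norm_ge0; rewrite -!(lnormZ hq)//.
apply: le_trans (lnormD hq _ _); last 2 first.
- by move=> *; rewrite mulr_ge0// level_norm_ge0.
- by move=> *; rewrite mulr_ge0// level_norm_ge0.
apply: ler_lnorm => // k _; rewrite level_norm_ge0 /=.
by apply: level_normD_le => // Q; exact: h.
Qed.

(** Bounds proved on truncations, uniformly in [K], are transferred to the extended-real cost by
    this equivalence. *)
Lemma cost_leP c M : 0 <= M ->
  (cost P p q c <= M%:E)%E <-> forall K, trunc_cost K c <= M.
Proof.
move=> M0; rewrite /cost /trunc_cost; case: q hq => [t t1|_|//].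
  have t0 : 0 < t by rewrite (lt_le_trans ltr01).
  have E k : level_sum P p c k `^ (t / p) = level_norm c k `^ t.
    by rewrite (level_sumE hP) mulrC powRrM.
  under eq_eseriesr do rewrite E.
  set S := (\sum_(k <oo) _)%E.
  have S0 : (0 <= S)%E by apply: nneseries_ge0 => *; rewrite lee_fin powR_ge0.
  have -> : (S `^ t^-1 <= M%:E)%E = (S <= (M `^ t)%:E)%E.
    move: S0; case: S => [x x0|_|//].
      by rewrite poweR_EFin !lee_fin powRV_le.
    by rewrite poweRyr ?invr_neq0 ?gt_eqF.
  rewrite nneseries_leP; last by move=> *; rewrite lee_fin powR_ge0.
  have h K : (lnorm t%:E (iota 0 K) (level_norm c) <= M) =
      (\sum_(0 <= k < K) (level_norm c k `^ t)%:E <= (M `^ t)%:E)%E.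
    by rewrite lnorm_fin_leP// sumEFin lee_fin /index_iota subn0.
  by split => H K; move: (H K); rewrite h.
have E k : level_sum P p c k `^ p^-1 = level_norm c k by rewrite (level_sumE hP).
split => [/ereal_supP h K|h].
  apply/lnorm_infty_leP => // k _.
  by rewrite -lee_fin -E; apply: h; exists k.
apply/ereal_supP => _ [k _ <-]; rewrite lee_fin E.
have /(lnorm_infty_leP _ _ (fun t => _) M0) := h k.+1; apply => //.
by rewrite mem_iota add0n ltnSn.
Qed.

Lemma cost_ge0 c : (0 <= cost P p q c)%E.
Proof.
rewrite /cost; case: q hq => [t _|_|//]; first exact: poweR_ge0.
apply: le_trans (ereal_sup_ubound _); last by exists 0%N.
by rewrite lee_fin powR_ge0.
Qed.

Lemma cost_fin c : (cost P p q c < +oo)%E ->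
  exists2 M, 0 <= M & cost P p q c = M%:E.
Proof.
by move: (cost_ge0 c); case: (cost P p q c) => // M M0 _; exists M.
Qed.

Lemma trunc_cost_le_cost c K M : cost P p q c = M%:E -> trunc_cost K c <= M.
Proof.
move=> cM; have M0 : 0 <= M by rewrite -lee_fin -cM cost_ge0.
by move: K; apply/cost_leP => //; rewrite cM.
Qed.

End representations.

(** * Reduction to canonical atoms *)

Section canonical_atoms.
Context {d : measure_display} {T : measurableType d} {R : realType}.
Variable m : {finite_measure set T -> \bar R}.
Variables (l1 l2 : R) (P : nat -> set (set T)).
Hypothesis hP : good_grid m l1 l2 P.
Variables (s p : R) (q : \bar R).
Hypotheses (hp : 1 <= p) (hq : (1 <= q)%E) (hs : 0 < s < p^-1).
Implicit Types (Q J : set T) (c : set T -> R[i]) (f g : T -> R[i]) (M : R).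

Let p0 : 0 < p := p_gt0 hp.
Let s0 : 0 < s := s_gt0 hs.

(** The largest modulus allowed to an atom on [Q]. Its inverse [atom_heightV] turns the value of a
    step function on a cell into a coefficient. *)
Definition atom_height Q : R := vol m Q `^ (s - p^-1).
Definition atom_heightV Q : R := vol m Q `^ (p^-1 - s).

Lemma atom_heightVE Q : atom_heightV Q = vol m Q `^ (p^-1 - s). Proof. by []. Qed.

Lemma atom_height_ge0 Q : 0 <= atom_height Q. Proof. exact: powR_ge0. Qed.

Lemma atom_heightV_ge0 Q : 0 <= atom_heightV Q. Proof. exact: powR_ge0. Qed.

Lemma atom_heightVK k Q : P k Q -> atom_heightV Q * atom_height Q = 1.
Proof.
move=> PQ; rewrite /atom_heightV /atom_height -opprB powRN mulVf// gt_eqF// powR_gt0//.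
exact: cell_vol_gt0 hP _ _ PQ.
Qed.

(** In other words the canonical atom has L^p norm |Q|^s, the source of the powers of [l2 ^ s]. *)
Lemma atom_height_powR k Q : P k Q -> atom_height Q `^ p * vol m Q = vol m Q `^ (s * p).
Proof.
move=> PQ; have v0 := cell_vol_gt0 hP PQ.
rewrite /atom_height -powRrM mulrBl mulVf ?gt_eqF//.
rewrite -{2}(powRr1 (ltW v0)) -powRD ?subrK//.
by apply/implyP => _; rewrite gt_eqF.
Qed.

Definition catom Q x : R[i] := (atom_height Q * \1_Q x)%:C%C.

Lemma catom_souza Q : souza_atom m s p Q (catom Q).
Proof.
split.
- by move=> x y Qx Qy; rewrite /catom !indicE !mem_set.
- by move=> x Qx; rewrite /catom indicE memNset// mulr0.
- move=> x; have c0 : 0 <= atom_height Q * \1_Q x.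
    by apply: mulr_ge0; [exact: powR_ge0|rewrite indicE ler0n].
  rewrite /catom normc_real (ger0_norm c0).
  by rewrite ler_piMr ?powR_ge0// indicE lern1 leq_b1.
Qed.

Definition coef c Q : R[i] := c Q * (atom_height Q)%:C%C.

Lemma coefE c Q : coef c Q = c Q * (atom_height Q)%:C%C.
Proof. by []. Qed.

Lemma level_catom c k : level P c catom k = step P k (coef c).
Proof.
apply/funext => x; rewrite (levelE hP) /step; apply: eq_bigr => Q _.
by rewrite /catom /coef -mulrA rmorphM.
Qed.

(** An atom is its constant value [z Q] on the cell times the indicator. The ratio of [z Q] to the
    maximal height has modulus at most 1 and is absorbed by the coefficient, which then determines
    the representation. *)
Lemma normalize_atoms g c a : (forall k Q, P k Q -> souza_atom m s p Q (a Q)) ->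
  exists c', (forall k Q, P k Q -> nc (c' Q) <= nc (c Q)) /\
    forall k, level P c a k = level P c' catom k.
Proof.
move=> ha; pose z Q := xget 0 [set z | exists2 x, Q x & a Q x = z].
have zE k Q x : P k Q -> Q x -> a Q x = z Q.
  move=> PQ Qx; rewrite /z; case: xgetP => [_ _ [y Qy <-]|/(_ (a Q x))].
    by have [h _ _] := ha _ _ PQ; exact: h.
  by case; exists x.
exists (fun Q => c Q * (z Q * (atom_heightV Q)%:C%C)); split => [k Q PQ|k].
  rewrite Normc.normcM ler_piMr ?normc_ge0//.
  have [x Qx] := cell_neq0 hP PQ.
  rewrite Normc.normcM -(zE _ _ _ PQ Qx) normc_real ger0_norm ?powR_ge0//.
  have [_ _ /(_ x) h] := ha _ _ PQ.
  rewrite -(atom_heightVK PQ) mulrC ler_wpM2l ?powR_ge0//.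
apply/funext => x; rewrite !(levelE hP); apply: eq_big_seq => Q /(cells_P hP) PQ.
rewrite -mulrA; congr (_ * _); rewrite /catom indicE.
have [Qx|nQx] := pselect (Q x).
  by rewrite mem_set// mulr1 -mulrA -rmorphM (atom_heightVK PQ) mulr1 (zE _ _ _ PQ Qx).
have [_ h _] := ha _ _ PQ.
by rewrite memNset// mulr0 mulr0 h.
Qed.

(** Only L^p convergence is asked; the summability of the norms of the levels follows from a finite
    cost. *)
Definition canonical_rep g c : Prop :=
  (fun n : nat => cLnorm m p%:E (fun x => g x - \sum_(k < n) step P k (coef c) x))
    @ \oo --> 0%E.

Lemma canonical_rep_levels g c (lv : nat -> T -> R[i]) :
  (forall k, lv k = step P k (coef c)) ->
  ((fun n : nat => cLnorm m p%:E (fun x => g x - \sum_(k < n) lv k x))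
    @ \oo --> 0%E) <-> canonical_rep g c.
Proof. by move=> /funext ->. Qed.

Local Notation theta := (l2 `^ s).

Lemma theta_ge0 : 0 <= theta. Proof. exact: powR_ge0. Qed.

Lemma theta_exprn n : theta ^+ n = (l2 ^+ n) `^ s.
Proof.
rewrite -(powR_mulrn n (powR_ge0 l2 s)) -(powR_mulrn n (ltW (l2_gt0 hP))).
exact: powRAC.
Qed.

Lemma theta_lt1 : theta < 1.
Proof.
have := @gt0_ltr_powR R s s0 l2 1; rewrite powR1; apply; rewrite ?nnegrE//.
- by rewrite ltW// (l2_gt0 hP).
- exact: l2_lt1 hP.
Qed.

Lemma cell_vol_le k Q : P k Q -> vol m Q <= l2 ^+ k * vol m setT.
Proof.
rewrite -{1}[k]add0n => PQ; have [Q0 [+ _ vQ]] := ancestor hP PQ.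
by rewrite (gg_root hP) => /= Q0T; rewrite Q0T in vQ.
Qed.

(** Since the cells are disjoint, the p-th power of the norm is the sum of |c_Q|^p |Q|^(sp), and |Q|
    is at most l2^k |I|. The geometric decay makes the levels summable as soon as their l^p norms
    are bounded, whatever [q] is. *)
Lemma cLnorm_step_coef c k :
  (cLnorm m p%:E (step P k (coef c)) <=
   (vol m setT `^ s * theta ^+ k * level_norm P p c k)%:E)%E.
Proof.
have V0 : 0 <= vol m setT := vol_ge0 _ _.
apply/cLnorm_fin_leP => //.
  by rewrite !mulr_ge0 ?powR_ge0 ?exprn_ge0 ?lnorm_ge0// theta_ge0.
rewrite (integral_step_powR hP)// lee_fin.
rewrite powRM ?mulr_ge0 ?powR_ge0 ?exprn_ge0 ?theta_ge0 ?lnorm_ge0//.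
rewrite /level_norm /lnorm powRVK ?gt_eqF//; last first.
  by rewrite sumr_ge0// => *; exact: powR_ge0.
rewrite mulr_sumr big_seq [leRHS]big_seq; apply: ler_sum => Q /(cells_P hP) PQ.
rewrite setIT Normc.normcM normc_real (ger0_norm (atom_height_ge0 _)).
rewrite (powRM _ (normc_ge0 _) (atom_height_ge0 _)) -mulrA (atom_height_powR PQ) mulrC.
rewrite ler_wpM2r ?powR_ge0// powRrM ler_powRl ?powR_ge0 ?(ltW p0)//.
have -> : vol m setT `^ s * theta ^+ k = (l2 ^+ k * vol m setT) `^ s.
  by rewrite powRM ?exprn_ge0 ?(ltW (l2_gt0 hP))// mulrC theta_exprn.
by rewrite ler_powRl ?(ltW s0) ?(vol_ge0 m)// cell_vol_le.
Qed.

Lemma level_norm_le_trunc_cost c k : level_norm P p c k <= trunc_cost P p q k.+1 c.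
Proof.
apply: (le_lnorm (a := level_norm P p c)) => //; last by rewrite mem_iota add0n ltnSn.
by move=> *; exact: level_norm_ge0.
Qed.

Lemma sum_cLnorm_step_lty c : (cost P p q c < +oo)%E ->
  (\sum_(k <oo) cLnorm m p%:E (step P k (coef c)) < +oo)%E.
Proof.
move=> /(cost_fin hq)[M M0 cM].
apply: (@le_lt_trans _ _ (vol m setT `^ s * M * (1 - theta)^-1)%:E); last exact: ltry.
apply/nneseries_leP => [n|n]; first exact: cLnorm_ge0.
apply: (@le_trans _ _ (\sum_(0 <= k < n) (vol m setT `^ s * M * theta ^+ k)%:E)%E).
  apply: lee_sum => k _; apply: le_trans (cLnorm_step_coef c k) _.
  rewrite lee_fin mulrAC ler_wpM2r ?exprn_ge0 ?theta_ge0//.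
  rewrite ler_wpM2l ?powR_ge0// (le_trans (level_norm_le_trunc_cost _ _))//.
  exact: (trunc_cost_le_cost hP hq _ cM).
rewrite sumEFin lee_fin -mulr_sumr ler_wpM2l ?mulr_ge0 ?powR_ge0//.
by rewrite big_mkord sum_geometric_le// theta_ge0 theta_lt1.
Qed.

Lemma canonical_rep_atomic g c : (cost P p q c < +oo)%E -> canonical_rep g c ->
  atomic_rep m P s p g c catom.
Proof.
move=> hc hr; split.
- by move=> k Q _; exact: catom_souza.
- under eq_eseriesr do rewrite level_catom.
  exact: sum_cLnorm_step_lty.
- by apply/(@canonical_rep_levels g c (level P c catom)) => // k; exact: level_catom.
Qed.

Lemma atomic_rep_canonical g c a : atomic_rep m P s p g c a -> exists c',
  [/\ forall k Q, P k Q -> nc (c' Q) <= nc (c Q), canonical_rep g c' &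
      (cost P p q c' <= cost P p q c)%E].
Proof.
move=> [ha _ hr]; have [c' [c'c hl]] := normalize_atoms g c ha.
exists c'; split; first exact: c'c.
  have e k : level P c a k = step P k (coef c') by rewrite hl level_catom.
  exact: (iffLR (canonical_rep_levels g e) hr).
have [->|] := eqVneq (cost P p q c) +oo%E; first exact: leey.
rewrite -ltey => /(cost_fin hq)[M M0 cM]; rewrite cM.
apply: (iffRL (cost_leP hP p hq c' M0)) => K.
apply: le_trans (le_trunc_cost hP hp hq _ c'c) _.
exact: (trunc_cost_le_cost hP hq _ cM).
Qed.

End canonical_atoms.

(** * The martingale representation *)

Section cLp_closure.
Context {d : measure_display} {T : measurableType d} {R : realType}.
Variable m : {measure set T -> \bar R}.
Implicit Types (f g : T -> R[i]) (p : \bar R).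

Lemma cLpD p f g : (1 <= p)%E -> cLp m p f -> cLp m p g ->
  cLp m p (fun x => f x + g x).
Proof.
move=> p1 [mf lf] [mg lg]; split; first exact: cmeasurableD.
by apply: le_lt_trans (cLnormD m p1 mf mg) _; exact: lte_add_pinfty.
Qed.

Lemma cLpZ p (c : R[i]) f : (1 <= p)%E -> cLp m p f -> cLp m p (fun x => c * f x).
Proof.
move=> p1 [mf lf]; split; first exact: cmeasurableM (cmeasurable_cst _) mf.
by rewrite cLnormZ// lte_mul_pinfty// ?lee_fin ?normc_ge0.
Qed.

Lemma cLpB p f g : (1 <= p)%E -> cLp m p f -> cLp m p g ->
  cLp m p (fun x => f x - g x).
Proof.
move=> p1 lf lg; have := cLpD p1 lf (cLpZ (-1) p1 lg).
by under eq_fun do rewrite mulN1r.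
Qed.

Lemma cLp0 p : (1 <= p)%E -> cLp m p (fun=> 0).
Proof. by move=> p1; split; [exact: cmeasurable_cst|rewrite cLnorm0]. Qed.

Lemma cLp_sum p (F : nat -> T -> R[i]) n : (1 <= p)%E -> (forall i, cLp m p (F i)) ->
  cLp m p (fun x => \sum_(i < n) F i x).
Proof.
move=> p1 lF; elim: n => [|n IH].
  by under eq_fun do rewrite big_ord0; exact: cLp0.
by under eq_fun do rewrite big_ord_recr/=; exact: cLpD.
Qed.

End cLp_closure.

Section martingale_coefficients.
Context {d : measure_display} {T : measurableType d} {R : realType}.
Variable m : {finite_measure set T -> \bar R}.
Variables (l1 l2 : R) (P : nat -> set (set T)).
Hypothesis hP : good_grid m l1 l2 P.
Variables (s p : R).
Hypotheses (hp : 1 <= p) (hs : 0 < s < p^-1).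
Implicit Types (Q J : set T) (v w c : set T -> R[i]) (f g h : T -> R[i]) (M : R).

Let p0 : 0 < p := p_gt0 hp.
Let s0 : 0 < s := s_gt0 hs.
Local Notation atom_height := (atom_height m s p).
Local Notation atom_heightV := (atom_heightV m s p).
Local Notation coef := (coef m s p).
Local Notation cells := (cells P).
Local Notation step := (step P).
Local Notation avg := (avg m).
Local Notation theta := (l2 `^ s).

(** Left general in [v], so as to apply to products of averages, which are not averages of a single
    function. *)
Definition mcoef v Q : R[i] := (atom_heightV Q)%:C%C * (v Q - v (parent P Q)).

Lemma mcoefE v Q : mcoef v Q = (atom_heightV Q)%:C%C * (v Q - v (parent P Q)).
Proof. by []. Qed.

Lemma coef_mcoef v k Q : P k Q -> coef (mcoef v) Q = v Q - v (parent P Q).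
Proof.
move=> PQ; rewrite /coef /mcoef mulrAC -rmorphM (atom_heightVK hP _ _ PQ) mul1r//.
Qed.

(** The jumps telescope along the ancestors of [Q]; the last value subtracted, at the parent of the
    root, is [v set0]. *)
Lemma sum_step_mcoef v n Q x : v set0 = 0 -> P n Q -> Q x ->
  \sum_(k < n.+1) step k (coef (mcoef v)) x = v Q.
Proof.
move=> v0; elim: n Q => [|n IH] Q PQ Qx; rewrite big_ord_recr/=.
  rewrite big_ord0 add0r (stepE hP _ PQ Qx) (coef_mcoef _ PQ).
  have -> : Q = setT by move: PQ; rewrite (gg_root hP).
  by rewrite (parent_root hP) v0 subr0.
have [PJ QJ] := parentP hP PQ.
rewrite (IH _ PJ (QJ _ Qx)) (stepE hP _ PQ Qx) (coef_mcoef _ PQ).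
by rewrite addrC subrK.
Qed.

Lemma ae_cells n : {ae m, forall x, exists2 Q, P n Q & Q x}.
Proof.
have mU : measurable (\bigcup_(Q in P n) Q).
  rewrite -bigsetU_fset_set; last exact: gg_finite hP n.
  rewrite big_seq; apply: bigsetU_measurable => Q.
  by rewrite in_fset_set ?inE; [exact: gg_measurable hP n Q|exact: gg_finite hP n].
exists (~` \bigcup_(Q in P n) Q); split.
- exact: measurableC.
- exact: gg_cover hP n.
- by move=> x /= h [Q PQ Qx]; apply: h; exists Q.
Qed.

Lemma ae_sum_step_mcoef v n : v set0 = 0 ->
  {ae m, forall x, \sum_(k < n.+1) step k (coef (mcoef v)) x = step n v x}.
Proof.
move=> v0; apply: filterS (ae_cells n) => x [Q PQ Qx].
by rewrite (sum_step_mcoef v0 PQ Qx) (stepE hP _ PQ Qx).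
Qed.

Lemma canonical_rep_mcoef f v : cmeasurable f -> v set0 = 0 ->
  (fun n : nat => cLnorm m p%:E (fun x => f x - step n v x)) @ \oo --> 0%E ->
  canonical_rep m P s p f (mcoef v).
Proof.
move=> mf v0 /cvge0P h; apply/cvge0P => [n|e e0]; first exact: cLnorm_ge0.
have [|N hN] := h _ e e0; first by move=> n; exact: cLnorm_ge0.
(* The sum of the first [n.+1] differences is the step function of level [n], hence the shift of the
   threshold. *)
exists N.+1 => -[//|n]; rewrite ltnS => /hN; apply: le_trans.
apply: (le_cLnorm (lee1_EFin hp)).
- apply: cmeasurableB mf _; apply: cmeasurable_sum => k; exact: cmeasurable_step hP _ _.
- by apply: cmeasurableB mf _; exact: cmeasurable_step hP _ _.
- by apply: filterS (ae_sum_step_mcoef n v0) => x ->.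
Qed.

Lemma cLp_step k v : cLp m p%:E (step k v).
Proof.
split; first exact: cmeasurable_step hP _ _.
rewrite cLnorm_finE (integral_step_powR hP)//.
by rewrite poweR_lty// ltry.
Qed.

Lemma sum_cells_integral_le k (h : T -> R) : measurable_fun setT h ->
  (forall x, 0 <= h x) ->
  (\sum_(Q <- cells k) \int[m]_(x in Q) (h x)%:E <= \int[m]_x (h x)%:E)%E.
Proof.
move=> mh h0.
have mhQ Q : Q \in cells k -> measurable_fun setT ((EFin \o h) \_ Q).
  move=> /(cells_measurable hP) mQ; apply/measurable_restrict => //.
  by rewrite setTI; apply/measurable_EFinP; apply: measurable_funS mh.
rewrite (_ : (\sum_(Q <- cells k) _ = \sum_(Q <- cells k)
  \int[m]_x (if Q \in cells k then ((EFin \o h) \_ Q) x else 0))%E); last first.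
  by apply: eq_big_seq => Q Qk; rewrite Qk integral_mkcond.
rewrite -ge0_integral_sum//; last 2 first.
- by move=> Q; case Qk : (Q \in cells k); [exact: mhQ|exact: measurable_cst].
- by move=> Q x _; case: ifP => // _; rewrite patchE; case: ifP => // _; rewrite lee_fin.
apply: ge0_le_integral => //.
- move=> x _; apply: sume_ge0 => Q _; case: ifP => // _.
  by rewrite patchE; case: ifP => // _; rewrite lee_fin.
- apply: emeasurable_sum => Q.
  by case Qk : (Q \in cells k); [exact: mhQ|exact: measurable_cst].
- exact/measurable_EFinP.
move=> x _.
have [[Q PQ Qx]|nx] := pselect (exists2 Q, P k Q & Q x).
  rewrite (bigD1_seq Q) ?(P_cells hP)// ?cells_uniq//= patchE mem_set//.
  rewrite big1_seq ?adde0// => J /andP[JQ Jk]; rewrite Jk patchE memNset// => Jx.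
  by rewrite (cell_eq hP PQ (cells_P hP Jk) Qx Jx) eqxx in JQ.
rewrite big1_seq ?lee_fin// => J /andP[_ Jk]; rewrite Jk patchE memNset// => Jx.
by apply: nx; exists J => //; exact: (cells_P hP).
Qed.

(** Jensen's inequality on each cell, summed over the disjoint cells of the level. *)
Lemma cLnorm_step_avg_le k f : cLp m p%:E f ->
  (cLnorm m p%:E (step k (avg f)) <= cLnorm m p%:E f)%E.
Proof.
move=> lf; have [mf fin] := lf.
rewrite !cLnorm_finE; apply: gt0_ler_poweR.
- by rewrite invr_ge0 ltW.
- by rewrite in_itv/= integral_ge0 ?leey// => x _; rewrite lee_fin powR_ge0.
- by rewrite in_itv/= integral_ge0 ?leey// => x _; rewrite lee_fin powR_ge0.
rewrite (integral_step_powR hP)//.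
have mfp : measurable_fun setT (fun x => nc (f x) `^ p).
  by apply/measurable_EFinP; exact: measurable_normc_powR.
apply: le_trans (sum_cells_integral_le k mfp (fun x => powR_ge0 _ _)).
rewrite -sumEFin big_seq [leRHS]big_seq; apply: lee_sum => Q Qk.
rewrite setIT mulrC; apply: avg_jensen => //.
- exact: (cells_measurable hP Qk).
- exact: cell_vol_gt0 hP _ _ (cells_P hP Qk).
Qed.

Lemma step_cst_on i k w Q x y : (i <= k)%N -> P k Q -> Q x -> Q y ->
  step i w x = step i w y.
Proof.
move=> ik; rewrite -(subnKC ik) => PQ Qx Qy.
have [Q0 [PQ0 QQ0 _]] := ancestor hP PQ.
by rewrite !(stepE hP _ PQ0)//; exact: QQ0.
Qed.

Lemma avg_step_cst i k w Q x : (i <= k)%N -> P k Q -> Q x ->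
  avg (step i w) Q = step i w x.
Proof.
move=> ik PQ Qx; apply: avg_cst_on.
- exact: gg_measurable hP _ _ PQ.
- exact: cell_vol_gt0 hP _ _ PQ.
- exact: (cLp_cL1 hp (cLp_step _ _)).
- by move=> y Qy; apply: step_cst_on ik PQ Qy Qx.
Qed.

End martingale_coefficients.

(** * Martingale differences of one level of a representation *)

Section martingale_estimates.
Context {d : measure_display} {T : measurableType d} {R : realType}.
Variable m : {finite_measure set T -> \bar R}.
Variables (l1 l2 : R) (P : nat -> set (set T)).
Hypothesis hP : good_grid m l1 l2 P.
Variables (s p : R).
Hypotheses (hp : 1 <= p) (hs : 0 < s < p^-1).
Implicit Types (Q J : set T) (v w c : set T -> R[i]) (f g h : T -> R[i]) (M : R).

Let p0 : 0 < p := p_gt0 hp.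
Let s0 : 0 < s := s_gt0 hs.
Let p1 : (1 <= p%:E)%E := lee1_EFin hp.
Local Notation atom_height := (atom_height m s p).
Local Notation atom_heightV := (atom_heightV m s p).
Local Notation coef := (coef m s p).
Local Notation cells := (cells P).
Local Notation step := (step P).
Local Notation avg := (avg m).
Local Notation theta := (l2 `^ s).
Local Notation mcoef := (mcoef m P s p).
Local Notation level_norm := (level_norm P p).

Lemma sum_cells_indic_le1 k x : \sum_(Q <- cells k) (\1_Q x : R) <= 1.
Proof.
have [[Q PQ Qx]|nx] := pselect (exists2 Q, P k Q & Q x).
  rewrite (bigD1_seq Q) ?(P_cells hP)// ?cells_uniq//= indicE mem_set//.
  rewrite big1_seq ?addr0// => J /andP[JQ Jk]; rewrite indicE memNset// => Jx.
  by rewrite (cell_eq hP PQ (cells_P hP Jk) Qx Jx) eqxx in JQ.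
rewrite big1_seq ?ler01// => J /andP[_ Jk]; rewrite indicE memNset// => Jx.
by apply: nx; exists J => //; exact: (cells_P hP).
Qed.

Lemma sum_cells_vol_le k J : measurable J ->
  \sum_(Q <- cells k) vol m (J `&` Q) <= vol m J.
Proof.
move=> mJ.
rewrite -lee_fin -sumEFin volE//.
rewrite -[leRHS](_ : (\int[m]_x (\1_J x)%:E)%E = _); last first.
  by rewrite integral_indic// setIT.
rewrite big_seq; under eq_bigr => Q Qk.
  have mQ := cells_measurable hP Qk.
  rewrite volE; last exact: measurableI.
  rewrite -(integral_indic m mQ mJ); over.
rewrite -big_seq; apply: (sum_cells_integral_le hP k).
- exact: measurable_indic.
- by move=> x; rewrite indicE ler0n.
Qed.

Lemma atom_heightV_powR k Q : P k Q -> vol m Q `^ (s * p) * atom_heightV Q `^ p = vol m Q.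
Proof.
move=> PQ; have v0 := cell_vol_gt0 hP PQ.
rewrite atom_heightVE -powRrM mulrBl mulVf ?gt_eqF// -powRD; last first.
  by apply/implyP => _; rewrite gt_eqF.
by rewrite addrC subrK powRr1// ltW.
Qed.

(** By Jensen's inequality |Q| |avg|^p is at most the sum of |c_J|^p |J|^(sp) over the cells J of
    level i inside Q. There |J| <= l2^(i-k) |Q|, so dividing by |Q|^(sp) leaves the power of
    [theta]; in the sum over Q each J occurs at most once. *)
Lemma avg_level_le c k i : (k <= i)%N ->
  lnorm p%:E (cells k) (fun Q => atom_heightV Q * nc (avg (step i (coef c)) Q)) <=
  theta ^+ (i - k) * level_norm c i.
Proof.
move=> ki; have th0 : 0 <= theta ^+ (i - k) by rewrite exprn_ge0// powR_ge0.
rewrite lnorm_fin_leP//; last by rewrite mulr_ge0// lnorm_ge0.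
rewrite powRM// ?lnorm_ge0// level_normE /lnorm powRVK ?gt_eqF//; last first.
  by rewrite sumr_ge0// => *; exact: powR_ge0.
have pt Q : P k Q -> (atom_heightV Q * nc (avg (step i (coef c)) Q)) `^ p <=
    (theta ^+ (i - k)) `^ p *
      \sum_(J <- cells i) nc (c J) `^ p * (`[< J `<=` Q >])%:R.
  move=> PQ; have mQ := gg_measurable hP PQ; have v0 := cell_vol_gt0 hP PQ.
  rewrite (powRM _ (atom_heightV_ge0 _ _ _ _) (normc_ge0 _)).
  set y := nc _; have V0 : 0 < vol m Q `^ (s * p) by rewrite powR_gt0.
  (* The factor |Q|^(sp) turns the weight on the left into |Q|, as Jensen's inequality requires. *)
  rewrite -(ler_pM2l V0) mulrA (atom_heightV_powR PQ).
  have := avg_jensen mQ v0 hp (cLp_step hP hp i (coef c)).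
  rewrite (integral_step_powR hP)// lee_fin => /le_trans; apply.
  rewrite mulr_sumr mulr_sumr big_seq [leRHS]big_seq; apply: ler_sum => J Ji.
  have PJ := cells_P hP Ji; have mJ := cells_measurable hP Ji.
  rewrite Normc.normcM normc_real (ger0_norm (atom_height_ge0 _ _ _ _)).
  rewrite (powRM _ (normc_ge0 _) (atom_height_ge0 _ _ _ _)).
  have [[x [Jx Qx]]|nx] := pselect (exists x, J x /\ Q x).
    have [JQ vJ] := cell_nested hP ki PQ PJ Qx Jx.
    rewrite (setIidl JQ) asboolT// mulr1 -mulrA (atom_height_powR hP s hp PJ).
    rewrite mulrA mulrC ler_wpM2r ?powR_ge0// (theta_exprn hP s) -powRrM mulrC.
    rewrite -powRM ?(ltW v0) ?exprn_ge0 ?(ltW (l2_gt0 hP))//.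
    rewrite mulrC in vJ; apply: ler_powRl vJ; last exact: vol_ge0.
    by rewrite mulr_ge0 ?(ltW s0) ?(ltW p0).
  rewrite (_ : J `&` Q = set0); last first.
    by apply/seteqP; split=> // x [Jx Qx]; apply: nx; exists x.
  rewrite /vol measure0 mulr0 mulr_ge0// ?powR_ge0// mulr_ge0 ?powR_ge0//.
  by rewrite mulr_ge0 ?powR_ge0.
rewrite big_seq; apply: (@le_trans _ _ (\sum_(Q <- cells k) (theta ^+ (i - k)) `^ p *
      \sum_(J <- cells i) nc (c J) `^ p * (`[< J `<=` Q >])%:R)).
  by rewrite [leRHS]big_seq; apply: ler_sum => Q Qk; apply: pt; exact: (cells_P hP).
rewrite -mulr_sumr ler_wpM2l ?powR_ge0// exchange_big/=.
rewrite big_seq [leRHS]big_seq; apply: ler_sum => J Ji.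
rewrite -mulr_sumr ler_piMr ?powR_ge0//.
have [x Jx] := cell_neq0 hP (cells_P hP Ji).
(* All the cells that contain [J] contain its point [x], so there is at most one of them. *)
apply: le_trans (sum_cells_indic_le1 k x); apply: ler_sum => Q _.
rewrite indicE; case: asboolP => [JQ|_]; last by rewrite ler0n.
by rewrite mem_set//; exact: JQ.
Qed.

(** The children of [J] are disjoint subsets of [J], each of volume at least [l1] times that of
    [J]. *)
Lemma sum_children_le k J : P k J ->
  \sum_(Q <- cells k.+1) (parent P Q == J)%:R <= l1^-1.
Proof.
move=> PJ; have v0 := cell_vol_gt0 hP PJ; have l10 := l1_gt0 hP.
have vl : 0 < l1 * vol m J by rewrite mulr_gt0.
rewrite -(ler_pM2l vl) [leRHS]mulrAC divff ?gt_eqF// mul1r mulr_sumr.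
apply: le_trans (sum_cells_vol_le k.+1 (gg_measurable hP PJ)).
rewrite big_seq [leRHS]big_seq; apply: ler_sum => Q Qk.
have [PP QP] := parentP hP (cells_P hP Qk).
case: eqP => [PQJ|_]; last by rewrite mulr0 vol_ge0.
rewrite mulr1; rewrite PQJ in QP PP.
rewrite (setIidr QP).
by have /andP[] := child_vol hP (cells_P hP Qk) PJ QP.
Qed.

(** The exponent 1/p - s is positive, so the weight of a cell is at most that of its parent.
    Grouping the cells by parent, each parent is counted at most 1/l1 times inside the p-th root. *)
Lemma lnorm_parent_le k (a : set T -> R) : (forall J, 0 <= a J) ->
  lnorm p%:E (cells k.+1) (fun Q => atom_heightV Q * a (parent P Q)) <=
  l1 `^ (- p^-1) * lnorm p%:E (cells k) (fun J => atom_heightV J * a J).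
Proof.
move=> a0; rewrite lnorm_fin_leP//; last by rewrite mulr_ge0 ?powR_ge0 ?lnorm_ge0.
rewrite powRM ?powR_ge0 ?lnorm_ge0// /lnorm powRVK ?gt_eqF//; last first.
  by rewrite sumr_ge0// => *; exact: powR_ge0.
rewrite -powRrM mulNr mulVf ?gt_eqF// powR_inv1; last exact: ltW (l1_gt0 hP).
pose G J := (atom_heightV J * a J) `^ p.
apply: (@le_trans _ _ (\sum_(Q <- cells k.+1) \sum_(J <- cells k)
    (parent P Q == J)%:R * G J)).
  rewrite big_seq [leRHS]big_seq; apply: ler_sum => Q Qk.
  have [PP QP] := parentP hP (cells_P hP Qk).
  rewrite (bigD1_seq (parent P Q)) ?(P_cells hP)// ?cells_uniq//= eqxx mul1r.
  rewrite big1 ?addr0; last by move=> J; rewrite eq_sym => /negPf ->; rewrite mul0r.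
  apply: ler_powRl; [exact: ltW|by rewrite mulr_ge0// atom_heightV_ge0|].
  apply: ler_wpM2r => //; apply: ler_powRl.
  - by rewrite subr_ge0 ltW// (s_ltVp hs).
  - exact: vol_ge0.
  - apply: le_vol => //; first exact: cells_measurable hP _ _ Qk.
    exact: gg_measurable hP _ _ PP.
rewrite exchange_big/= mulr_sumr big_seq [leRHS]big_seq; apply: ler_sum => J Jk.
rewrite -mulr_suml ler_wpM2r ?powR_ge0//.
by apply: sum_children_le; exact: (cells_P hP).
Qed.

Local Notation B := (l1 `^ (- p^-1)).

Lemma level_norm_mcoef_le v k : v set0 = 0 ->
  level_norm (mcoef v) k <= lnorm p%:E (cells k) (fun Q => atom_heightV Q * nc (v Q)) +
    (if k is k'.+1
     then B * lnorm p%:E (cells k') (fun Q => atom_heightV Q * nc (v Q)) else 0).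
Proof.
move=> v0.
have W (w : set T -> set T) Q : 0 <= atom_heightV Q * nc (v (w Q)).
  by rewrite mulr_ge0 ?normc_ge0 ?atom_heightV_ge0.
apply: (@le_trans _ _ (lnorm p%:E (cells k) (fun Q => atom_heightV Q * nc (v Q)) +
    lnorm p%:E (cells k) (fun Q => atom_heightV Q * nc (v (parent P Q))))).
  apply: le_trans (lnormD p1 _ _); last 2 first.
  - by move=> Q _; exact: (W id).
  - by move=> Q _; exact: W.
  apply: ler_lnorm => // Q _; rewrite normc_ge0 /= Normc.normcM normc_real.
  by rewrite ger0_norm ?atom_heightV_ge0// -mulrDr ler_wpM2l ?atom_heightV_ge0// normcB_le.
rewrite lerD2l; case: k => [|k]; last first.
  by apply: (lnorm_parent_le k (a := fun Q => nc (v Q))) => Q; exact: normc_ge0.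
rewrite (@eq_lnorm _ _ _ _ _ (fun=> 0)) ?lnorm0// => Q /(cells_P hP).
by rewrite (gg_root hP) => -> ; rewrite (parent_root hP) v0 Normc.normc0 mulr0.
Qed.

(** The parent still lies at level [i] or deeper, so the step function is constant on it and both
    averages equal its value at a point of [Q]. *)
Lemma mcoef_level_eq0 c i k Q : (i < k)%N -> P k Q ->
  mcoef (avg (step i (coef c))) Q = 0.
Proof.
case: k => // k; rewrite ltnS => ik PQ; have [PJ QJ] := parentP hP PQ.
have [x Qx] := cell_neq0 hP PQ.
rewrite mcoefE (avg_step_cst hP hp _ _ PQ Qx); last exact: leqW.
by rewrite (avg_step_cst hP hp _ ik PJ (QJ _ Qx)) subrr mulr0.
Qed.

Lemma level_norm_mcoef_level_le c i k : (k <= i)%N ->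
  level_norm (mcoef (avg (step i (coef c)))) k <=
  (1 + B) * theta ^+ (i - k) * level_norm c i.
Proof.
move=> ki; apply: le_trans (level_norm_mcoef_le _ (avg_set0 _ _)) _.
rewrite -mulrA mulrDl mul1r; apply: lerD; first exact: avg_level_le.
case: k ki => [|k ki].
  by rewrite !mulr_ge0 ?powR_ge0 ?exprn_ge0 ?lnorm_ge0 ?powR_ge0.
rewrite ler_wpM2l ?powR_ge0//.
apply: le_trans (avg_level_le _ (ltnW ki)) _.
(* Parents are one generation further from level [i]; the extra factor [theta] is at most 1 and is
   dropped. *)
rewrite ler_wpM2r ?lnorm_ge0// -(subnSK ki) exprS ler_piMl ?exprn_ge0 ?powR_ge0//.
exact: ltW (theta_lt1 hP hs).
Qed.

End martingale_estimates.

(** Reindexing by [i = k + j], after the range has been enlarged to [k + n] by nonnegative terms. *)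
Lemma sum_from_le {R : numDomainType} (G : nat -> R) k n : (forall i, 0 <= G i) ->
  \sum_(i < n) (if (k <= i)%N then G i else 0) <= \sum_(j < n) G (k + j)%N.
Proof.
move=> G0; pose H i := if (k <= i)%N then G i else 0.
have H0 i : 0 <= H i by rewrite /H; case: ifP.
apply: (@le_trans _ _ (\sum_(i < k + n) H i)).
  rewrite -!(big_mkord xpredT H) [leRHS](big_cat_nat (n := n))//= ?leq_addl//.
  by rewrite lerDl sumr_ge0.
rewrite big_split_ord/= big1 ?add0r => [|i _].
  by apply: ler_sum => j _; rewrite /H leq_addr.
by rewrite /H leqNgt ltn_ord.
Qed.

(** * The standard cost against the cost of an arbitrary representation *)

Section standard_representation.
Context {d : measure_display} {T : measurableType d} {R : realType}.
Variable m : {finite_measure set T -> \bar R}.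
Variables (l1 l2 : R) (P : nat -> set (set T)).
Hypothesis hP : good_grid m l1 l2 P.
Variables (s p : R) (q : \bar R).
Hypotheses (hp : 1 <= p) (hq : (1 <= q)%E) (hs : 0 < s < p^-1).
Implicit Types (Q J : set T) (v w c : set T -> R[i]) (f g h : T -> R[i]) (M : R).

Let p0 : 0 < p := p_gt0 hp.
Let p1 : (1 <= p%:E)%E := lee1_EFin hp.
Local Notation atom_heightV := (atom_heightV m s p).
Local Notation coef := (coef m s p).
Local Notation cells := (cells P).
Local Notation step := (step P).
Local Notation avg := (avg m).
Local Notation theta := (l2 `^ s).
Local Notation mcoef := (mcoef m P s p).
Local Notation level_norm := (level_norm P p).
Local Notation trunc_cost := (trunc_cost P p q).
Local Notation B := (l1 `^ (- p^-1)).
Local Notation Lp := (cLp m p%:E).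
Local Notation cLnormp f := (cLnorm m p%:E f%R).

Lemma avgB f g Q : Lp f -> Lp g -> measurable Q ->
  avg (fun x => f x - g x) Q = avg f Q - avg g Q.
Proof.
move=> lf lg mQ; apply/eqP; rewrite eq_sym subr_eq; apply/eqP.
rewrite -avgD//; last 2 first.
- exact: cLp_cL1 hp (cLpB p1 lf lg).
- exact: cLp_cL1 hp lg.
by congr (avg _ _); apply/funext => x; rewrite subrK.
Qed.

Lemma avg0 Q : measurable Q -> avg (fun=> 0) Q = 0.
Proof.
move=> mQ; rewrite -[RHS](subrr (avg (fun=> 0) Q)) -avgB//; try exact: cLp0.
by congr (avg _ _); apply/funext => x; rewrite subrr.
Qed.

Lemma avg_sum (F : nat -> T -> R[i]) n Q : (forall i, Lp (F i)) -> measurable Q ->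
  avg (fun x => \sum_(i < n) F i x) Q = \sum_(i < n) avg (F i) Q.
Proof.
move=> lF mQ; elim: n => [|n IH].
  by under eq_fun do rewrite big_ord0; rewrite avg0// big_ord0.
under eq_fun do rewrite big_ord_recr/=; rewrite big_ord_recr/= -IH avgD//.
- exact: cLp_cL1 hp (cLp_sum _ p1 lF).
- exact: cLp_cL1 hp (lF n).
Qed.

Lemma parent_measurable k Q : P k Q -> measurable (parent P Q).
Proof.
case: k => [|k PQ].
  by rewrite (gg_root hP) => ->; rewrite (parent_root hP); exact: measurable0.
by have [PJ _] := parentP hP PQ; exact: gg_measurable hP _ _ PJ.
Qed.

Lemma mcoef_avgB f g k Q : Lp f -> Lp g -> P k Q ->
  mcoef (avg (fun x => f x - g x)) Q = mcoef (avg f) Q - mcoef (avg g) Q.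
Proof.
move=> lf lg PQ; rewrite !mcoefE -mulrBr; congr (_ * _).
rewrite !avgB//; [ring|exact: parent_measurable PQ|exact: gg_measurable hP _ _ PQ].
Qed.

Lemma mcoef_avg_sum (F : nat -> T -> R[i]) n k Q : (forall i, Lp (F i)) -> P k Q ->
  mcoef (avg (fun x => \sum_(i < n) F i x)) Q = \sum_(i < n) mcoef (avg (F i)) Q.
Proof.
move=> lF PQ; rewrite mcoefE !avg_sum//; last 2 first.
- exact: parent_measurable PQ.
- exact: gg_measurable hP _ _ PQ.
by rewrite -sumrB mulr_sumr; apply: eq_bigr => i _; rewrite mcoefE.
Qed.

Definition partial c n x : R[i] := \sum_(i < n) step i (coef c) x.

Lemma cLp_partial c n : Lp (partial c n).
Proof. exact: (cLp_sum n p1 (fun i => cLp_step hP hp i (coef c))). Qed.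

(** Levels above the k-th difference in the tree cancel. The others are indexed by their distance
    [j] to [k], so that Minkowski's inequality over [k] can be applied for each fixed [j]. *)
Lemma level_norm_mcoef_partial_le c n k :
  level_norm (mcoef (avg (partial c n))) k <=
  \sum_(j < n) (1 + B) * theta ^+ j * level_norm c (k + j)%N.
Proof.
pose F i := step i (coef c).
have lF i : Lp (F i) by exact: (cLp_step hP hp).
have B0 : 0 <= 1 + B by rewrite addr_ge0 ?powR_ge0.
apply: (@le_trans _ _ (\sum_(i < n) level_norm (mcoef (avg (F i))) k)).
  rewrite level_normE.
  apply: (@le_trans _ _ (lnorm p%:E (cells k)
      (fun Q => \sum_(i < n) nc (mcoef (avg (F i)) Q)))).
    apply: ler_lnorm => // Q /(cells_P hP) PQ.
    by rewrite normc_ge0 (mcoef_avg_sum _ lF PQ)/= normc_sum.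
  apply: (lnorm_sum n p1 (a := fun i Q => nc (mcoef (avg (F i)) Q))) => *.
  exact: normc_ge0.
pose G i := (1 + B) * theta ^+ (i - k) * level_norm c i.
have G0 i : 0 <= G i by rewrite !mulr_ge0 ?exprn_ge0 ?powR_ge0 ?level_norm_ge0.
apply: (@le_trans _ _ (\sum_(i < n) if (k <= i)%N then G i else 0)).
  apply: ler_sum => i _; case: leqP => [ki|ik].
    exact: (level_norm_mcoef_level_le hP hp hs).
  rewrite level_normE (@eq_lnorm _ _ _ _ _ (fun=> 0)) ?lnorm0// => Q /(cells_P hP) PQ.
  by rewrite (mcoef_level_eq0 hP s hp _ ik PQ) Normc.normc0.
apply: le_trans (sum_from_le k n G0) _.
by apply: ler_sum => j _; rewrite /G addKn.
Qed.

Definition standard_const : R := (1 + B) / (1 - theta).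

Lemma standard_const_ge0 : 0 <= standard_const.
Proof.
apply: divr_ge0; first by rewrite addr_ge0 ?powR_ge0.
by rewrite subr_ge0 ltW// (theta_lt1 hP hs).
Qed.

Lemma trunc_cost_partial_le c M n K : (forall K, trunc_cost K c <= M) ->
  trunc_cost K (mcoef (avg (partial c n))) <= standard_const * M.
Proof.
move=> cM; have M0 : 0 <= M by apply: le_trans (cM 0%N); exact: lnorm_ge0.
have B0 : 0 <= 1 + B by rewrite addr_ge0 ?powR_ge0.
pose G j k := (1 + B) * theta ^+ j * level_norm c (k + j)%N.
apply: (@le_trans _ _ (lnorm q (iota 0 K) (fun k => \sum_(j < n) G j k))).
  by apply: ler_lnorm => // k _; rewrite level_norm_ge0 /= level_norm_mcoef_partial_le.
apply: le_trans (lnorm_sum n hq _) _.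
  by move=> j k _; rewrite /G !mulr_ge0 ?exprn_ge0 ?powR_ge0 ?level_norm_ge0.
apply: (@le_trans _ _ (\sum_(j < n) (1 + B) * theta ^+ j * M)).
  apply: ler_sum => j _; rewrite /G lnormZ//; last 2 first.
  - by rewrite mulr_ge0 ?exprn_ge0 ?powR_ge0.
  - by move=> *; exact: level_norm_ge0.
  rewrite ler_wpM2l ?mulr_ge0 ?exprn_ge0 ?powR_ge0//.
  (* The shift by [j] reads levels up to [K + j], which is why the bound on [c] is assumed for every
     truncation. *)
  apply: le_trans (cM (K + j)%N).
  by apply: lnorm_iota_shift => // i; exact: level_norm_ge0.
rewrite -mulr_suml ler_wpM2r// -mulr_sumr /standard_const ler_wpM2l//.
by rewrite sum_geometric_le// powR_ge0 (theta_lt1 hP hs).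
Qed.

Lemma normc_avg_cLnorm_le h N k Q : Lp h -> 0 <= N -> (cLnormp h <= N%:E)%E ->
  P k Q -> nc (avg h Q) <= vol m Q `^ (- p^-1) * N.
Proof.
move=> lh N0 hN PQ; have v0 := cell_vol_gt0 hP PQ.
have mQ := gg_measurable hP PQ; set y := nc _; have y0 : 0 <= y := normc_ge0 _.
rewrite -(powRK y0 (lt0r_neq0 p0)) powRV_le ?powR_ge0//; last first.
  by rewrite mulr_ge0 ?powR_ge0.
rewrite powRM ?powR_ge0// -powRrM mulNr mulVf ?gt_eqF// powR_inv1; last exact: ltW.
rewrite ler_pdivlMl// -lee_fin; apply: le_trans (avg_jensen mQ v0 hp lh) _.
apply: le_trans (iffLR (cLnorm_fin_leP m h p0 N0) hN).
apply: ge0_subset_integral => //; first exact: measurable_normc_powR lh.1.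
by move=> x _; rewrite lee_fin powR_ge0.
Qed.

(** A level has finitely many cells. The constant depends on their volumes and hence on [k], which
    continuity at a fixed level allows. *)
Lemma level_norm_mcoef_avg_bound k : exists D : R, 0 <= D /\
  forall h N, Lp h -> 0 <= N -> (cLnormp h <= N%:E)%E ->
    level_norm (mcoef (avg h)) k <= D * N.
Proof.
pose D Q := atom_heightV Q * (vol m Q `^ (- p^-1) + vol m (parent P Q) `^ (- p^-1)).
have D0 Q : 0 <= D Q by rewrite mulr_ge0 ?atom_heightV_ge0// addr_ge0 ?powR_ge0.
exists (lnorm p%:E (cells k) D); split => [|h N lh N0 hN]; first exact: lnorm_ge0.
rewrite mulrC -(lnormZ p1 N0 (fun Q _ => D0 Q)); apply: ler_lnorm => // Q /(cells_P hP) PQ.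
rewrite normc_ge0 andTb mcoefE Normc.normcM normc_real ger0_norm ?atom_heightV_ge0//.
rewrite /D mulrCA ler_wpM2l ?atom_heightV_ge0// mulrDr.
apply: le_trans (normcB_le _ _) _; apply: lerD; rewrite mulrC.
  exact: normc_avg_cLnorm_le lh N0 hN PQ.
case: k PQ => [|k] PQ; last first.
  by have [PJ _] := parentP hP PQ; exact: normc_avg_cLnorm_le lh N0 hN PJ.
move: PQ; rewrite (gg_root hP) => ->.
by rewrite (parent_root hP) avg_set0 Normc.normc0 mulr_ge0 ?powR_ge0.
Qed.

Lemma level_norm_mcoef_avg_unif_bound K : exists D : R, 0 < D /\
  forall k h N, (k < K)%N -> Lp h -> 0 <= N -> (cLnormp h <= N%:E)%E ->
    level_norm (mcoef (avg h)) k <= D * N.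
Proof.
elim: K => [|K [D [D0 hD]]]; first by exists 1; split.
have [E [E0 hE]] := level_norm_mcoef_avg_bound K.
exists (D + E); split => [|k h N]; first by rewrite ltr_wpDr.
rewrite ltnS leq_eqVlt => /predU1P[->|kK] lh N0 hN.
  by apply: le_trans (hE h N lh N0 hN) _; rewrite ler_wpM2r// lerDr ltW.
by apply: le_trans (hD k h N kK lh N0 hN) _; rewrite ler_wpM2r// lerDl.
Qed.

(** One constant [D] serves the levels below [K]: an L^p error [e / D] moves each of their norms by
    at most [e]. That [D] depends on [K] is harmless, since [M] is not affected by it. *)
Lemma trunc_cost_avg_approx K f M : Lp f ->
  (forall e, 0 < e -> exists h, [/\ Lp h, (cLnormp (fun x => f x - h x) <= e%:E)%E &
     trunc_cost K (mcoef (avg h)) <= M]) ->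
  trunc_cost K (mcoef (avg f)) <= M.
Proof.
move=> lf happ; have [D [D0 hD]] := level_norm_mcoef_avg_unif_bound K.
apply: lnorm_approx => // [k _|e e0]; first exact: level_norm_ge0.
have [h [lh fh hM]] := happ _ (divr_gt0 e0 D0).
exists (level_norm (mcoef (avg h))); first by split => // k _; exact: level_norm_ge0.
move=> k; rewrite mem_iota add0n => /andP[_ kK].
have eD0 : 0 <= e / D by rewrite divr_ge0// ltW.
have := hD _ _ _ kK (cLpB p1 lf lh) eD0 fh.
rewrite mulrC divfK ?gt_eqF// => /(lerD (lexx (level_norm (mcoef (avg h)) k))).
apply: le_trans; rewrite -[X in _ <= X + _]mul1r -[X in _ <= _ + X]mul1r.
apply: (level_normD_le hP hp) => // Q PQ; rewrite !mul1r (mcoef_avgB lf lh PQ).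
have := normcD_le (mcoef (avg h) Q) (mcoef (avg f) Q - mcoef (avg h) Q).
by rewrite [mcoef (avg h) Q + _]addrC subrK.
Qed.

Lemma canonical_rep_approx f c e : Lp f -> canonical_rep m P s p f c -> 0 < e ->
  exists N, forall n, (N <= n)%N -> (cLnormp (fun x => f x - partial c n x) <= e%:E)%E.
Proof.
move=> lf /cvge0P h e0; apply: h => // n; exact: cLnorm_ge0.
Qed.

Lemma trunc_cost_standard_le f c M K : Lp f -> canonical_rep m P s p f c ->
  (forall K, trunc_cost K c <= M) -> trunc_cost K (mcoef (avg f)) <= standard_const * M.
Proof.
move=> lf fc cM; apply: trunc_cost_avg_approx => // e e0.
have [N hN] := canonical_rep_approx lf fc e0; exists (partial c N); split.
- exact: cLp_partial.
- exact: hN.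
- exact: trunc_cost_partial_le.
Qed.

(** Isolated as a property because it passes to L^p limits, whether or not the limit is known to
    have a representation. *)
Definition martingale_cvg f : Prop := forall e : R, 0 < e ->
  exists N : nat, forall n, (N <= n)%N ->
    (cLnormp (fun x => f x - step n (avg f) x) <= e%:E)%E.

Lemma step_avgB n f g x : Lp f -> Lp g ->
  step n (avg (fun x => f x - g x)) x = step n (avg f) x - step n (avg g) x.
Proof.
move=> lf lg.
have [[Q PQ Qx]|nx] := pselect ((\bigcup_(Q in P n) Q) x).
  by rewrite !(stepE hP _ PQ Qx) avgB//; exact: gg_measurable hP _ _ PQ.
by rewrite !(step_out hP)// subrr.
Qed.

(** From level [n] on, the function is constant on every cell and so equals its own cell averages,
    except on the null set left uncovered. *)
Lemma martingale_cvg_partial c n : martingale_cvg (partial c n).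
Proof.
move=> e e0; exists n => k nk.
have mp := (cLp_partial c n).1.
rewrite (_ : cLnormp (_) = 0%E) ?lee_fin ?ltW//.
rewrite -[RHS](cLnorm0 m p1).
apply: (cLnorm_ae_eq p1 _ (cmeasurable_cst 0)).
  by apply: cmeasurableB mp _; exact: cmeasurable_step hP _ _.
apply: filterS (ae_cells hP k) => x [Q PQ Qx] _.
rewrite (stepE hP _ PQ Qx).
rewrite (avg_sum n (fun i => cLp_step hP hp i (coef c)) (gg_measurable hP PQ)).
apply/eqP; rewrite subr_eq0; apply/eqP; apply: eq_bigr => i _.
by rewrite (avg_step_cst hP hp _ _ PQ Qx)// (leq_trans _ nk)// ltnW.
Qed.

(** Write f - E_n f = (f - h) + (h - E_n h) - E_n (f - h); the last term is controlled by the
    contractivity of E_n, uniformly in [n]. *)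
Lemma martingale_cvg_approx f : Lp f ->
  (forall e, 0 < e -> exists h,
     [/\ Lp h, martingale_cvg h & (cLnormp (fun x => f x - h x) <= e%:E)%E]) ->
  martingale_cvg f.
Proof.
move=> lf happ e e0; have e3 : 0 < e / 3 by rewrite divr_gt0.
have [h [lh ch fh]] := happ _ e3; have [N hN] := ch _ e3.
exists N => n /hN hn.
have ms v : cmeasurable (step n v) by exact: cmeasurable_step hP _ _.
have mfh : cmeasurable (fun x => f x - h x) by exact: (cLpB p1 lf lh).1.
have mhs : cmeasurable (fun x => h x - step n (avg h) x).
  exact: cmeasurableB lh.1 (ms _).
have E : (fun x => f x - step n (avg f) x) = (fun x => ((f x - h x) +
    (h x - step n (avg h) x)) - step n (avg (fun x => f x - h x)) x).
  by apply/funext => x; rewrite step_avgB//; ring.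
rewrite E; apply: le_trans (cLnormB m p1 (cmeasurableD mfh mhs) (ms _)) _.
have -> : e%:E = (e / 3 + e / 3 + e / 3)%:E by congr EFin; lra.
rewrite !EFinD; apply: leeD.
  by apply: le_trans (cLnormD m p1 mfh mhs) _; exact: leeD.
by apply: le_trans (cLnorm_step_avg_le hP hp n (cLpB p1 lf lh)) _.
Qed.

Lemma canonical_rep_martingale_cvg f c : Lp f -> canonical_rep m P s p f c ->
  martingale_cvg f.
Proof.
move=> lf fc; apply: martingale_cvg_approx => // e e0.
have [N hN] := canonical_rep_approx lf fc e0; exists (partial c N); split.
- exact: cLp_partial.
- exact: martingale_cvg_partial.
- exact: hN.
Qed.

Lemma martingale_cvg_canonical_rep f : Lp f -> martingale_cvg f ->
  canonical_rep m P s p f (mcoef (avg f)).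
Proof.
move=> lf cf; apply: (canonical_rep_mcoef hP s hp lf.1 (avg_set0 m f)).
by apply/cvge0P => // n; exact: cLnorm_ge0.
Qed.

End standard_representation.

(** * Besov norms *)

Section besov_facts.
Context {d : measure_display} {T : measurableType d} {R : realType}.
Variable m : {finite_measure set T -> \bar R}.
Variables (l1 l2 : R) (P : nat -> set (set T)).
Hypothesis hP : good_grid m l1 l2 P.
Variables (s p : R) (q : \bar R).
Hypotheses (hp : 1 <= p) (hq : (1 <= q)%E) (hs : 0 < s < p^-1).
Implicit Types (Q J : set T) (v w c : set T -> R[i]) (f g h : T -> R[i]) (M : R).

Let p0 : 0 < p := p_gt0 hp.
Let p1 : (1 <= p%:E)%E := lee1_EFin hp.
Local Notation trunc_cost := (trunc_cost P p q).
Local Notation Lp := (cLp m p%:E).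
Local Notation cLnormp f := (cLnorm m p%:E f%R).
Local Notation canonical_rep := (canonical_rep m P s p).
Local Notation besov := (besov m P s p q).
Local Notation besov_norm := (besov_norm m P s p q).
Local Notation coef := (coef m s p).

Lemma canonical_repP f c : canonical_rep f c <-> forall e : R, 0 < e -> exists N : nat,
  forall n, (N <= n)%N ->
    (cLnormp (fun x => f x - \sum_(k < n) step P k (coef c) x) <= e%:E)%E.
Proof. by apply: cvge0P => n; exact: cLnorm_ge0. Qed.

Lemma cmeasurable_partial c n :
  cmeasurable (fun x => \sum_(k < n) step P k (coef c) x).
Proof. by apply: cmeasurable_sum => k; exact: cmeasurable_step hP _ _. Qed.

Lemma canonical_repD f g c c' : cmeasurable f -> cmeasurable g ->
  canonical_rep f c -> canonical_rep g c' ->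
  canonical_rep (fun x => f x + g x) (fun Q => c Q + c' Q).
Proof.
move=> mf mg /canonical_repP rf /canonical_repP rg; apply/canonical_repP => e e0.
have e2 : 0 < e / 2 by rewrite divr_gt0.
have [N1 h1] := rf _ e2; have [N2 h2] := rg _ e2.
exists (maxn N1 N2) => n; rewrite geq_max => /andP[/h1 {}h1 /h2 {}h2].
have -> : e%:E = (e / 2 + e / 2)%:E by congr EFin; lra.
rewrite EFinD; apply: le_trans (leeD h1 h2).
have mS := cmeasurable_partial.
apply: le_trans (cLnormD m p1 (cmeasurableB mf (mS c n)) (cmeasurableB mg (mS c' n))).
rewrite (_ : (fun x => f x + g x - _) = (fun x => f x - \sum_(k < n) step P k (coef c) x +
  (g x - \sum_(k < n) step P k (coef c') x)))//.
apply/funext => x; rewrite (_ : \sum_(k < n) _ = \sum_(k < n) step P k (coef c) x +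
  \sum_(k < n) step P k (coef c') x); first ring.
rewrite -big_split/=; apply: eq_bigr => k _; rewrite /step -big_split/=.
by apply: eq_bigr => Q _; rewrite !coefE !mulrDl.
Qed.

Lemma canonical_repZ f c (a : R[i]) : cmeasurable f -> canonical_rep f c ->
  canonical_rep (fun x => a * f x) (fun Q => a * c Q).
Proof.
move=> mf /canonical_repP rf; apply/canonical_repP => e e0.
have na : 0 < nc a + 1 by rewrite ltr_wpDl ?normc_ge0.
have [N h] := rf _ (divr_gt0 e0 na); exists N => n /h {}h.
rewrite (_ : (fun x => _) = (fun x => a * (f x - \sum_(k < n) step P k (coef c) x))).
  rewrite (cLnormZ _ _ p1 (cmeasurableB mf (cmeasurable_partial c n))).
  apply: (@le_trans _ _ ((nc a)%:E * (e / (nc a + 1))%:E)%E).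
    by rewrite lee_wpmul2l// lee_fin normc_ge0.
  rewrite -EFinM lee_fin mulrCA ler_piMr ?(ltW e0)// ler_pdivrMr// mul1r.
  by rewrite lerDl.
apply/funext => x; rewrite mulrBr mulr_sumr; congr (_ - _).
apply: eq_bigr => k _; rewrite /step mulr_sumr; apply: eq_bigr => Q _.
by rewrite !coefE !mulrA.
Qed.

Lemma canonical_rep0 : canonical_rep (fun=> 0) (fun=> 0).
Proof.
apply/canonical_repP => e e0; exists 0%N => n _.
rewrite (_ : (fun x => _) = (fun=> 0)); first by rewrite cLnorm0// lee_fin ltW.
apply/funext => x; rewrite big1 ?subrr// => k _; rewrite /step big1// => Q _.
by rewrite !coefE !mul0r.
Qed.

Lemma canonical_rep_ae_eq f g c : cmeasurable f -> cmeasurable g -> ae_eq m setT f g ->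
  canonical_rep f c -> canonical_rep g c.
Proof.
move=> mf mg fg /canonical_repP rf; apply/canonical_repP => e /rf[N h]; exists N => n /h.
apply: le_trans; apply: (le_cLnorm p1).
- exact: cmeasurableB mg (cmeasurable_partial c n).
- exact: cmeasurableB mf (cmeasurable_partial c n).
- by apply: filterS fg => x /(_ I) ->; exact: lexx.
Qed.

(** Arbitrary atoms, absolute convergence and extended-real costs are eliminated here from the
    membership condition. *)
Lemma besovP f : besov f <-> Lp f /\ exists c M,
  [/\ canonical_rep f c, 0 <= M & forall K, trunc_cost K c <= M].
Proof.
split=> [[lf [c [a [hr /(cost_fin hq)[M M0 cM]]]]]|[lf [c [M [hr M0 cM]]]]]; split => //.
  have [c' [_ hr' c'M]] := atomic_rep_canonical hP hp hq hr.
  exists c', M; split; [exact: hr'|exact: M0|].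
  by apply: (iffLR (cost_leP hP p hq c' M0)); rewrite -cM.
have cfin : (cost P p q c < +oo)%E.
  by apply: le_lt_trans (iffRL (cost_leP hP p hq c M0) cM) _; exact: ltry.
exists c, (catom m s p); split; last exact: cfin.
exact: (canonical_rep_atomic hP hp hq hs cfin hr).
Qed.

Lemma besov_norm_ge0 f : (0 <= besov_norm f)%E.
Proof. by apply/ereal_infP => _ [c [a [_ ->]]]; exact: cost_ge0. Qed.

Lemma besov_norm_le f c M : canonical_rep f c -> 0 <= M -> (forall K, trunc_cost K c <= M) ->
  (besov_norm f <= M%:E)%E.
Proof.
move=> hr M0 cM; have cc := iffRL (cost_leP hP p hq c M0) cM.
apply: le_trans (cc); apply: ereal_inf_lbound.
have cfin := le_lt_trans cc (ltry M).
by exists c, (catom m s p); split; first exact: (canonical_rep_atomic hP hp hq hs cfin hr).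
Qed.

Lemma besov_norm_fin f : besov f -> exists2 N, 0 <= N & besov_norm f = N%:E.
Proof.
move=> /besovP[_ [c [M [hr M0 cM]]]]; have := besov_norm_le hr M0 cM.
by move: (besov_norm_ge0 f); case: (besov_norm f) => // N N0 _; exists N.
Qed.

Lemma besov_norm_lt f (N e : R) : besov_norm f = N%:E -> 0 < e ->
  exists2 c, canonical_rep f c & forall K, trunc_cost K c <= N + e.
Proof.
move=> fN e0.
have : (besov_norm f < (N + e)%:E)%E by rewrite fN lte_fin ltrDl.
move=> /ereal_inf_lt[_ [c [a [hr ->]]] cN].
have [c' [_ hr' c'M]] := atomic_rep_canonical hP hp hq hr; exists c'; first exact: hr'.
have Ne0 : 0 <= N + e by rewrite -lee_fin (le_trans (cost_ge0 P p hq c)) ?ltW.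
by apply: (iffLR (cost_leP hP p hq c' Ne0)); rewrite (le_trans c'M)// ltW.
Qed.

Lemma besov_standard_le f (N : R) K : besov f -> besov_norm f = N%:E ->
  trunc_cost K (mcoef m P s p (avg m f)) <= standard_const l1 l2 s p * N.
Proof.
move=> [lf _] fN; have C0 := standard_const_ge0 hP hs.
apply/ler_addgt0Pr => e e0.
have C1 : 0 < standard_const l1 l2 s p + 1 by rewrite ltr_wpDl.
(* The infimum need not be attained; the slack [e / (C + 1)] stays below [e] after multiplication by
   the constant [C]. *)
have [c hr cM] := besov_norm_lt fN (divr_gt0 e0 C1).
apply: le_trans (trunc_cost_standard_le hP hp hq hs K lf hr cM) _.
rewrite mulrDr lerD2l mulrCA ler_piMr ?(ltW e0)// ler_pdivrMr// mul1r.
by rewrite lerDl.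
Qed.

Lemma besov_martingale_cvg f : besov f -> martingale_cvg m P p f.
Proof.
move=> /besovP[lf [c [M [hr _ _]]]].
exact: (canonical_rep_martingale_cvg hP hp lf hr).
Qed.

(** A criterion for limits of sequences, for which no representation is at hand beforehand. *)
Lemma besov_of_standard f M : Lp f -> martingale_cvg m P p f -> 0 <= M ->
  (forall K, trunc_cost K (mcoef m P s p (avg m f)) <= M) ->
  besov f /\ (besov_norm f <= M%:E)%E.
Proof.
move=> lf cf M0 fM; have hr := martingale_cvg_canonical_rep hP s hp lf cf; split.
  by apply/besovP; split => //; exists (mcoef m P s p (avg m f)), M; split; [exact: hr| |].
exact: besov_norm_le hr M0 fM.
Qed.

Lemma besov_normD f g : besov f -> besov g ->
  besov (fun x => f x + g x) /\
  (besov_norm (fun x => f x + g x)%R <= besov_norm f + besov_norm g)%E.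
Proof.
move=> bf bg; have [lf _] := bf; have [lg _] := bg.
have [N N0 fN] := besov_norm_fin bf; have [N' N'0 gN] := besov_norm_fin bg.
(* Used twice: with slack 1 for membership, with arbitrary slack for the norm. *)
have key e : 0 < e -> exists2 c, canonical_rep (fun x => f x + g x) c &
    forall K, trunc_cost K c <= N + N' + e.
  move=> e0; have e2 : 0 < e / 2 by rewrite divr_gt0.
  have [c hr cM] := besov_norm_lt fN e2; have [c' hr' cM'] := besov_norm_lt gN e2.
  exists (fun Q => c Q + c' Q); first exact: canonical_repD lf.1 lg.1 hr hr'.
  move=> K; have -> : N + N' + e = (N + e / 2) + (N' + e / 2) by lra.
  apply: le_trans (lerD (cM K) (cM' K)).
  rewrite -[X in _ <= X + _]mul1r -[X in _ <= _ + X]mul1r.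
  by apply: (trunc_costD_le hP hp hq) => // k Q PQ; rewrite !mul1r normcD_le.
split.
  apply/besovP; split; first exact: cLpD.
  have [c hr cM] := key _ ltr01; exists c, (N + N' + 1); split; [exact: hr| |exact: cM].
  by rewrite !addr_ge0.
rewrite fN gN -EFinD; apply/lee_addgt0Pr => e e0; have [c hr cM] := key _ e0.
by apply: besov_norm_le hr _ cM; rewrite !addr_ge0// ltW.
Qed.

(** An inequality is enough: the reverse one comes from applying it to the inverse scalar. *)
Lemma besov_normZ_le f (a : R[i]) : besov f ->
  besov (fun x => a * f x) /\
  (besov_norm (fun x => a * f x)%R <= (nc a)%:E * besov_norm f)%E.
Proof.
move=> bf; have [lf _] := bf; have [N N0 fN] := besov_norm_fin bf.
have key e : 0 < e -> exists2 c, canonical_rep (fun x => a * f x) c &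
    forall K, trunc_cost K c <= nc a * (N + e).
  move=> e0; have [c hr cM] := besov_norm_lt fN e0.
  exists (fun Q => a * c Q); first exact: canonical_repZ lf.1 hr.
  move=> K; apply: le_trans (ler_wpM2l (normc_ge0 a) (cM K)).
  rewrite -[leRHS]addr0 -(mul0r (trunc_cost K c)).
  apply: (trunc_costD_le hP hp hq) => //; first exact: normc_ge0.
  by move=> k Q PQ; rewrite mul0r addr0 Normc.normcM.
have n0 := normc_ge0 a.
split.
  apply/besovP; split; first exact: cLpZ.
  have [c hr cM] := key _ ltr01; exists c, (nc a * (N + 1)).
  by split; [exact: hr|rewrite mulr_ge0// addr_ge0|exact: cM].
rewrite fN -EFinM; apply/lee_addgt0Pr => e e0.
have na : 0 < nc a + 1 by rewrite ltr_wpDl.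
have [c hr cM] := key _ (divr_gt0 e0 na).
have e1 : 0 < e / (nc a + 1) by rewrite divr_gt0.
apply: (le_trans (besov_norm_le hr _ cM)); first by rewrite mulr_ge0// addr_ge0// ltW.
rewrite -EFinD lee_fin mulrDr lerD2l mulrCA ler_piMr ?(ltW e0)//.
by rewrite ler_pdivrMr// mul1r lerDl.
Qed.

Lemma besov0 : besov (fun=> 0) /\ besov_norm (fun=> 0) = 0%E.
Proof.
have z K : trunc_cost K (fun=> 0) <= 0.
  have : trunc_cost K (fun=> 0) <= 0 * trunc_cost K (fun=> 0) + 0 * trunc_cost K (fun=> 0).
    by apply: (trunc_costD_le hP hp hq) => // k Q PQ; rewrite Normc.normc0 mulr0 addr0.
  by rewrite !mul0r addr0.
split.
  apply/besovP; split; first exact: cLp0.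
  by exists (fun=> 0), 0; split; [exact: canonical_rep0| |exact: z].
by apply/eqP; rewrite eq_le besov_norm_ge0 andbT (besov_norm_le canonical_rep0 _ z).
Qed.

Lemma besov_ae_eq f g : besov f -> cmeasurable g -> ae_eq m setT f g ->
  besov g /\ besov_norm g = besov_norm f.
Proof.
move=> /besovP[lf [c [M [hr M0 cM]]]] mg fg; have mf := lf.1.
have gf : ae_eq m setT g f by apply: filterS fg => x /[apply] ->.
have lg : Lp g by split => //; rewrite -(cLnorm_ae_eq p1 mf mg fg); exact: lf.2.
have bf : besov f by apply/besovP; split => //; exists c, M; split.
have bg : besov g.
  apply/besovP; split => //; exists c, M.
  by split; [exact: canonical_rep_ae_eq fg hr|exact: M0|exact: cM].
split => //.
have le h h' : besov h -> cmeasurable h -> cmeasurable h' -> ae_eq m setT h h' ->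
    (besov_norm h' <= besov_norm h)%E.
  move=> bh mh mh' hh'; have [N N0 hN] := besov_norm_fin bh.
  rewrite hN; apply/lee_addgt0Pr => e e0; have [c' hr' cM'] := besov_norm_lt hN e0.
  apply: (besov_norm_le (canonical_rep_ae_eq mh mh' hh' hr') _ cM').
  by rewrite addr_ge0// ltW.
by apply/eqP; rewrite eq_le !le.
Qed.

End besov_facts.

(** * Products *)

Section multiplication.
Context {d : measure_display} {T : measurableType d} {R : realType}.
Variable m : {finite_measure set T -> \bar R}.
Variables (l1 l2 : R) (P : nat -> set (set T)).
Hypothesis hP : good_grid m l1 l2 P.
Variables (s p : R) (q : \bar R).
Hypotheses (hp : 1 <= p) (hq : (1 <= q)%E) (hs : 0 < s < p^-1).
Implicit Types (Q J : set T) (v w c : set T -> R[i]) (f g h : T -> R[i]) (M : R).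

Let p0 : 0 < p := p_gt0 hp.
Let p1 : (1 <= p%:E)%E := lee1_EFin hp.
Local Notation trunc_cost := (trunc_cost P p q).
Local Notation Lp := (cLp m p%:E).
Local Notation cLnormp f := (cLnorm m p%:E f%R).
Local Notation besov := (besov m P s p q).
Local Notation besov_norm := (besov_norm m P s p q).
Local Notation mcoef := (mcoef m P s p).
Local Notation avg := (avg m).
Local Notation step := (step P).
Local Notation standard_const := (standard_const l1 l2 s p).

Lemma cLp_infty_fin f : cLp m +oo%E f -> exists F : R,
  [/\ 0 <= F, cLnorm m +oo%E f = F%:E & {ae m, forall x, nc (f x) <= F}].
Proof.
move=> [mf]; have := ae_normc_le m mf; have := cLnorm_ge0 m +oo%E f.
case: (cLnorm m +oo%E f) => // F; by rewrite lee_fin => F0 h _; exists F.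
Qed.

Lemma cLnorm_bounded f (F : R) : cmeasurable f -> 0 <= F ->
  {ae m, forall x, nc (f x) <= F} ->
  (cLnormp f <= (F * vol m setT `^ p^-1)%:E)%E.
Proof.
move=> mf F0 fF; apply/cLnorm_fin_leP => //; first by rewrite mulr_ge0 ?powR_ge0.
rewrite powRM ?powR_ge0// powRVK ?gt_eqF ?vol_ge0//.
apply: (@le_trans _ _ (\int[m]_x (cst (F `^ p)%:E x))%E); last first.
  by rewrite integral_cst// EFinM volE.
apply: ae_ge0_le_integral => //.
- by move=> x _; rewrite lee_fin powR_ge0.
- exact: measurable_normc_powR.
- by move=> x _; rewrite lee_fin powR_ge0.
- apply: filterS fF => x fF _; rewrite lee_fin ler_powRl ?normc_ge0//.
  exact: ltW.
Qed.

Lemma cLp_infty_sub f : cLp m +oo%E f -> Lp f.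
Proof.
move=> lf; have [F [F0 _ fF]] := cLp_infty_fin lf; split; first exact: lf.1.
by apply: le_lt_trans (cLnorm_bounded lf.1 F0 fF) _; exact: ltry.
Qed.

Lemma normc_avg_cell_le h (H : R) k Q : Lp h -> 0 <= H ->
  {ae m, forall x, nc (h x) <= H} -> P k Q -> nc (avg h Q) <= H.
Proof.
move=> lh H0 hH PQ; apply: normc_avg_bounded => //.
- exact: gg_measurable hP _ _ PQ.
- exact: cell_vol_gt0 hP _ _ PQ.
- exact: cLp_cL1 hp lh.
Qed.

Lemma normc_avg_parent_le f (F : R) k Q : Lp f -> 0 <= F ->
  {ae m, forall x, nc (f x) <= F} -> P k Q -> nc (avg f (parent P Q)) <= F.
Proof.
move=> lf F0 fF; case: k => [|k] PQ.
  by move: PQ; rewrite (gg_root hP) => ->; rewrite (parent_root hP) avg_set0 Normc.normc0.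
by have [PJ _] := parentP hP PQ; exact: normc_avg_cell_le lf F0 fF PJ.
Qed.

(** * Product of two bounded functions *)

Section product.
Variables (f g : T -> R[i]) (F G : R).
Hypotheses (lf : Lp f) (lg : Lp g) (F0 : 0 <= F) (G0 : 0 <= G).
Hypotheses (fF : {ae m, forall x, nc (f x) <= F}).
Hypotheses (gG : {ae m, forall x, nc (g x) <= G}).

Let v Q := avg f Q * avg g Q.

(** The jump of a product is a b - a' b' = b (a - a') + a' (b - b'), where the primes denote
    averages over the parent; [b] and [a'] are bounded by the sup norms. *)
Lemma normc_mcoef_product_le k Q : P k Q ->
  nc (mcoef v Q) <= G * nc (mcoef (avg f) Q) + F * nc (mcoef (avg g) Q).
Proof.
move=> PQ.
have -> : mcoef v Q = avg g Q * mcoef (avg f) Q + avg f (parent P Q) * mcoef (avg g) Q.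
  by rewrite !mcoefE /v; ring.
apply: le_trans (normcD_le _ _) _.
rewrite (Normc.normcM (avg g Q)) (Normc.normcM (avg f (parent P Q))).
apply: lerD; apply: ler_wpM2r; rewrite ?normc_ge0//.
  exact: (normc_avg_cell_le lg G0 gG PQ).
exact: normc_avg_parent_le lf F0 fF PQ.
Qed.

Lemma step_product n x : step n v x = step n (avg f) x * step n (avg g) x.
Proof.
have [[Q PQ Qx]|nx] := pselect ((\bigcup_(Q in P n) Q) x).
  by rewrite !(stepE hP _ PQ Qx).
by rewrite !(step_out hP)// mul0r.
Qed.

Lemma normc_step_avg_le n x : nc (step n (avg f) x) <= F.
Proof.
have [[Q PQ Qx]|nx] := pselect ((\bigcup_(Q in P n) Q) x).
  by rewrite (stepE hP _ PQ Qx); exact: normc_avg_cell_le lf F0 fF PQ.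
by rewrite (step_out hP)// Normc.normc0.
Qed.

(** In fg - E_n f E_n g = g (f - E_n f) + E_n f (g - E_n g) each term pairs a function bounded
    uniformly in [n] with one that tends to 0 in L^p. *)
Lemma canonical_rep_product : martingale_cvg m P p f -> martingale_cvg m P p g ->
  canonical_rep m P s p (fun x => f x * g x) (mcoef v).
Proof.
move=> cf cg; have [mf _] := lf; have [mg _] := lg.
apply: (canonical_rep_mcoef hP s hp (cmeasurableM mf mg)).
  by rewrite /v avg_set0 mul0r.
apply/cvge0P => [n|e e0]; first exact: cLnorm_ge0.
have FG : 0 < F + G + 1 by rewrite ltr_wpDl// addr_ge0.
have [N1 h1] := cf _ (divr_gt0 e0 FG); have [N2 h2] := cg _ (divr_gt0 e0 FG).
exists (maxn N1 N2) => n; rewrite geq_max => /andP[/h1 {}h1 /h2 {}h2].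
have ms w : cmeasurable (step n w) by exact: cmeasurable_step hP _ _.
have mA : cmeasurable (fun x => g x * (f x - step n (avg f) x)).
  exact: cmeasurableM mg (cmeasurableB mf (ms _)).
have mB : cmeasurable (fun x => step n (avg f) x * (g x - step n (avg g) x)).
  exact: cmeasurableM (ms _) (cmeasurableB mg (ms _)).
have -> : (fun x => f x * g x - step n v x) =
    (fun x => g x * (f x - step n (avg f) x) +
              step n (avg f) x * (g x - step n (avg g) x)).
  by apply/funext => x; rewrite step_product; ring.
apply: le_trans (cLnormD m p1 mA mB) _.
apply: (@le_trans _ _ (G%:E * (e / (F + G + 1))%:E + F%:E * (e / (F + G + 1))%:E)%E).
  apply: leeD.
    apply: le_trans (cLnormM_le p1 mg (cmeasurableB mf (ms _)) G0 gG) _.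
    by rewrite lee_wpmul2l.
  have sF : {ae m, forall x, nc (step n (avg f) x) <= F}.
    by apply: nearW => x; exact: normc_step_avg_le.
  apply: le_trans (cLnormM_le p1 (ms _) (cmeasurableB mg (ms _)) F0 sF) _.
  by rewrite lee_wpmul2l.
rewrite -!EFinM -EFinD lee_fin -mulrDl mulrCA ler_piMr ?(ltW e0)//.
by rewrite ler_pdivrMr// mul1r [G + F]addrC lerDl.
Qed.

Lemma besov_product (A B : R) : martingale_cvg m P p f -> martingale_cvg m P p g ->
  0 <= A -> 0 <= B ->
  (forall K, trunc_cost K (mcoef (avg f)) <= A) ->
  (forall K, trunc_cost K (mcoef (avg g)) <= B) ->
  besov (fun x => f x * g x) /\
  (besov_norm (fun x => f x * g x)%R <= (G * A + F * B)%:E)%E.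
Proof.
move=> cf cg A0 B0 fA gB; have hr := canonical_rep_product cf cg.
have AB0 : 0 <= G * A + F * B by rewrite addr_ge0 ?mulr_ge0.
have hM K : trunc_cost K (mcoef v) <= G * A + F * B.
  apply: (@le_trans _ _
    (G * trunc_cost K (mcoef (avg f)) + F * trunc_cost K (mcoef (avg g)))).
    by apply: (trunc_costD_le hP hp hq) => // k Q PQ; exact: normc_mcoef_product_le PQ.
  by rewrite lerD// ler_wpM2l.
split; last exact: (besov_norm_le hP hp hq hs hr AB0 hM).
apply: (iffRL (besovP hP hp hq hs _)); split; last first.
  by exists (mcoef v), (G * A + F * B); split; [exact: hr|exact: AB0|exact: hM].
have [mf _] := lf; have [mg _] := lg.
split; first exact: cmeasurableM.
apply: le_lt_trans (cLnormM_le p1 mf mg F0 fF) _.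
by rewrite lte_mul_pinfty// lg.2.
Qed.

End product.

(** This allows |f|_oo |g|_oo, the bound for the sup norm of the product, to be absorbed under the
    same constant. *)
Lemma standard_const_ge1 : 1 <= standard_const.
Proof.
have t1 : 0 < 1 - l2 `^ s by rewrite subr_gt0 (theta_lt1 hP hs).
rewrite /standard_const ler_pdivlMr// mul1r.
by apply: (@le_trans _ _ 1); [rewrite gerBl powR_ge0|rewrite lerDl powR_ge0].
Qed.

(** Since [C_H] is at least 1 and the maximum at least its second entry, the second term of [C_e] is
    at least l1^(-2-s). This dominates l1^(-1/p), because l1 <= 1 and 1/p <= 1 < 2 + s. *)
Lemma C_e_ge : 1 + l1 `^ (- p^-1) <= C_e l1 l2 s p.
Proof.
have l10 := l1_gt0 hP; have l11 : l1 <= 1.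
  by have [_ [/ltW h1 /ltW h2]] := gg_lambda hP; exact: le_trans h2.
have H1 : 1 <= C_H l1 l2.
  by rewrite /C_H lerDr divr_ge0 ?powR_ge0// mulr_ge0 ?sqrtr_ge0 ?powR_ge0.
rewrite /C_e lerD2l -mulrA.
apply: (@le_trans _ _ (1 * (l1 `^ (p^-1 - s) * l1 `^ (- 2 - p^-1)))); last first.
  apply: ler_pM => //; first by rewrite mulr_ge0 ?powR_ge0.
  by rewrite ler_wpM2r ?powR_ge0// le_max lexx orbT.
rewrite mul1r -powRD; last by apply/implyP => _; rewrite gt_eqF.
apply: ger_powR; first by rewrite l10.
have : p^-1 <= 1 by rewrite invf_le1.
by have := s_gt0 hs; lra.
Qed.

Lemma Gamma_ge0 : (0 <= Gamma m P s q)%E.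
Proof.
rewrite /Gamma; case: (hoelder_conjugate q) => [r||]; first exact: poweR_ge0.
- apply: (@le_trans _ _ (mesh m P 0 `^ s)%:E); first by rewrite lee_fin powR_ge0.
  by apply: ereal_sup_ubound; exists 0%N.
- apply: (@le_trans _ _ (mesh m P 0 `^ s)%:E); first by rewrite lee_fin powR_ge0.
  by apply: ereal_sup_ubound; exists 0%N.
Qed.

(** The numerator is bounded by [C_e], and [C_o] dominates its summand 1 / (1 - l2^s) since the
    other one is nonnegative. *)
Lemma standard_const_le_CeCo : (standard_const%:E <= (C_e l1 l2 s p)%:E * C_o m P l2 s q)%E.
Proof.
have t1 : 0 < 1 - l2 `^ s by rewrite subr_gt0 (theta_lt1 hP hs).
have C0 : 0 <= C_e l1 l2 s p.
  by apply: le_trans C_e_ge; rewrite addr_ge0 ?powR_ge0.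
apply: (@le_trans _ _ ((C_e l1 l2 s p)%:E * (1 / (1 - l2 `^ s))%:E)%E).
  rewrite -EFinM lee_fin mulrA mulr1 /standard_const ler_pM2r ?invr_gt0//.
  exact: C_e_ge.
apply: lee_wpmul2l; first by rewrite lee_fin.
by rewrite /C_o leeDr// mule_ge0 ?Gamma_ge0// lee_fin powR_ge0.
Qed.

Lemma besov_Linfty_mul f g : besov_Linfty m P s p q f -> besov_Linfty m P s p q g ->
  besov_Linfty m P s p q (f \* g) /\
  (besov_Linfty_norm m P s p q (f \* g)%R <=
   standard_const%:E * besov_Linfty_norm m P s p q f * besov_Linfty_norm m P s p q g)%E.
Proof.
move=> [bf lf] [bg lg].
have [F [F0 fF aF]] := cLp_infty_fin lf; have [G [G0 gG aG]] := cLp_infty_fin lg.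
have [A A0 fA] := besov_norm_fin hP hp hq hs bf.
have [B B0 gB] := besov_norm_fin hP hp hq hs bg.
have C0 := standard_const_ge0 hP hs.
have [bfg nfg] := besov_product (cLp_infty_sub lf) (cLp_infty_sub lg) F0 G0 aF aG
  (besov_martingale_cvg hP hp hq hs bf) (besov_martingale_cvg hP hp hq hs bg)
  (mulr_ge0 C0 A0) (mulr_ge0 C0 B0)
  (fun K => besov_standard_le hP hp hq hs K bf fA)
  (fun K => besov_standard_le hP hp hq hs K bg gB).
have FG0 : 0 <= F * G by rewrite mulr_ge0.
have nb : {ae m, forall x, nc (f x * g x) <= F * G}.
  apply: filterS2 aF aG => x fx gx; rewrite Normc.normcM.
  by apply: ler_pM; rewrite ?normc_ge0.
have noo := iffRL (cLnorm_infty_leP m (fun x => f x * g x) FG0) nb.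
split.
  split; first exact: bfg.
  split; first exact: cmeasurableM lf.1 lg.1.
  by apply: le_lt_trans noo _; exact: ltry.
rewrite /besov_Linfty_norm fA gB fF gG -!EFinD -!EFinM.
apply: le_trans (leeD nfg noo) _; rewrite -EFinD lee_fin.
have C1 := standard_const_ge1; rewrite -subr_ge0.
(* With C the constant, C (A + F) (B + G) exceeds G C A + F C B + F G by this amount. *)
rewrite (_ : _ - _ = (standard_const - 1) * (F * G) + standard_const * (A * B)); last by ring.
have C10 : 0 <= standard_const - 1 by rewrite subr_ge0.
exact: addr_ge0 (mulr_ge0 C10 FG0) (mulr_ge0 C0 (mulr_ge0 A0 B0)).
Qed.

End multiplication.

(** * Completeness *)

Section complex_cauchy.
Context {R : realType}.

Lemma cauchy_real_cvg (a : nat -> R) :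
  (forall e : R, 0 < e -> exists N : nat, forall i j : nat,
     (N <= i)%N -> (N <= j)%N -> `|a i - a j| <= e) ->
  cvgn a.
Proof.
move=> h; apply: cauchy_cvg; apply: cauchy_exP => e e0.
have [N hN] := h _ (divr_gt0 e0 (ltr0n R 2)).
exists (a N); exists N => // n /= Nn; rewrite /ball /= (le_lt_trans (hN _ _ _ Nn))//.
by rewrite gtr_pMr// invf_lt1 ?ltr1n.
Qed.

Definition clim (z : nat -> R[i]) : R[i] :=
  (limn (fun n => complex.Re (z n)) +i* limn (fun n => complex.Im (z n)))%C.

Variable z : nat -> R[i].
Hypothesis zC : forall e : R, 0 < e -> exists N : nat, forall i j : nat,
  (N <= i)%N -> (N <= j)%N -> nc (z i - z j) <= e.

Lemma clim_Re : (fun n => complex.Re (z n)) @ \oo --> complex.Re (clim z).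
Proof.
apply: (cauchy_real_cvg _) => e /zC[N hN]; exists N => i j iN jN.
by rewrite -raddfB (le_trans (Re_le_normc _))// hN.
Qed.

Lemma clim_Im : (fun n => complex.Im (z n)) @ \oo --> complex.Im (clim z).
Proof.
apply: (cauchy_real_cvg _) => e /zC[N hN]; exists N => i j iN jN.
by rewrite -raddfB (le_trans (Im_le_normc _))// hN.
Qed.

(** Closed balls contain the limits of their sequences. It turns the uniform Cauchy estimate into an
    estimate of the distance to the limit. *)
Lemma clim_le (w : R[i]) (M : R) (N : nat) :
  (forall j : nat, (N <= j)%N -> nc (w - z j) <= M) -> nc (w - clim z) <= M.
Proof.
move=> h; apply/ler_addgt0Pr => e e0; have e2 : 0 < e / 2 by rewrite divr_gt0.
have /cvgrPdist_le/(_ _ e2)[N1 _ h1] := clim_Re.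
have /cvgrPdist_le/(_ _ e2)[N2 _ h2] := clim_Im.
pose j := maxn N (maxn N1 N2).
have jN : (N <= j)%N by rewrite leq_maxl.
have jN1 : (N1 <= j)%N by rewrite /j maxnCA leq_maxl.
have jN2 : (N2 <= j)%N by rewrite /j maxnA leq_maxr.
rewrite (_ : w - clim z = (w - z j) - (clim z - z j)); last by ring.
apply: le_trans (normcB_le _ _) _; apply: lerD; first exact: h.
apply: le_trans (normc_le_ReIm _) _; rewrite !raddfB/=.
have := h1 _ jN1; have := h2 _ jN2 => /=; lra.
Qed.

End complex_cauchy.

(** * Completeness of L^oo *)

Section Linfty_complete.
Context {d : measure_display} {T : measurableType d} {R : realType}.
Variable m : {measure set T -> \bar R}.

Lemma Linfty_complete (u : nat -> T -> R[i]) : (forall n, cmeasurable (u n)) ->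
  (forall e : R, 0 < e -> exists N : nat, forall i j : nat,
     (N <= i)%N -> (N <= j)%N -> (cLnorm m +oo%E (fun x => u i x - u j x)%R <= e%:E)%E) ->
  exists2 f, cmeasurable f & forall e : R, 0 < e -> exists N : nat,
    forall n, (N <= n)%N -> (cLnorm m +oo%E (fun x => u n x - f x)%R <= e%:E)%E.
Proof.
move=> mu uC.
(* The pairs of indices are countably many, so a single null set works for all of them. *)
have : {ae m, forall x, forall i j,
    ((nc (u i x - u j x))%:E <= cLnorm m +oo%E (fun x => u i x - u j x)%R)%E}.
  apply: ae_foralln => i; apply: ae_foralln => j.
  exact: (ae_normc_le m (cmeasurableB (mu i) (mu j))).
move=> [N [mN N0 hN]].
(* Set to 0 on the null set, the sequence is Cauchy at every point, and the limit is measurable as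
   an everywhere pointwise limit. *)
pose w n x := u n x * (\1_(~` N) x : R)%:C%C.
have mw n : cmeasurable (w n).
  exact: cmeasurableM (mu n) (cmeasurable_indic (measurableC mN)).
have wu n x : ~ N x -> w n x = u n x.
  by move=> nx; rewrite /w indicE mem_set// mulr1.
have unif e : 0 < e -> exists K : nat, forall i j : nat, (K <= i)%N -> (K <= j)%N ->
    forall x, ~ N x -> nc (u i x - u j x) <= e.
  move=> e0; have [K hK] := uC _ e0; exists K => i j iK jK x nx.
  rewrite -lee_fin; apply: le_trans (hK i j iK jK).
  by have [//|h] := pselect (forall i j, ((nc (u i x - u j x))%:E <=
    cLnorm m +oo%E (fun x => u i x - u j x)%R)%E); case: nx; exact: hN.
have wC x e : 0 < e -> exists K : nat, forall i j : nat, (K <= i)%N -> (K <= j)%N ->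
    nc (w i x - w j x) <= e.
  move=> e0; have [K hK] := unif e e0; exists K => i j iK jK.
  have [Nx|nx] := pselect (N x); last by rewrite !wu//; exact: hK.
  by rewrite /w indicE memNset ?mulr0 ?subrr ?Normc.normc0 ?(ltW e0)//; exact.
pose f x := clim (fun n => w n x).
have mf : cmeasurable f.
  split.
    apply: (measurable_fun_cvg (fun n => (mw n).1)) => x _.
    exact: clim_Re (wC x).
  apply: (measurable_fun_cvg (fun n => (mw n).2)) => x _.
  exact: clim_Im (wC x).
exists f => // e e0; have [K hK] := unif e e0; exists K => n nK.
apply/cLnorm_infty_leP; first exact: ltW.
exists N; split => // x /= h; apply: contrapT => nx; apply: h.
apply: (clim_le (wC x) (N := K)) => j jK.
by rewrite wu//; exact: hK.
Qed.

End Linfty_complete.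

Section completeness.
Context {d : measure_display} {T : measurableType d} {R : realType}.
Variable m : {finite_measure set T -> \bar R}.
Variables (l1 l2 : R) (P : nat -> set (set T)).
Hypothesis hP : good_grid m l1 l2 P.
Variables (s p : R) (q : \bar R).
Hypotheses (hp : 1 <= p) (hq : (1 <= q)%E) (hs : 0 < s < p^-1).

Let p0 : 0 < p := p_gt0 hp.
Let p1 : (1 <= p%:E)%E := lee1_EFin hp.
Local Notation trunc_cost := (trunc_cost P p q).
Local Notation cLnormp f := (cLnorm m p%:E f%R).
Local Notation besov := (besov m P s p q).
Local Notation besov_norm := (besov_norm m P s p q).
Local Notation A := (besov_Linfty m P s p q).
Local Notation N := (besov_Linfty_norm m P s p q).

Lemma besovB f g : besov f -> besov g -> besov (fun x => f x - g x).
Proof.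
move=> bf bg; have [bg' _] := besov_normZ_le hP hp hq hs (-1) bg.
have [h _] := besov_normD hP hp hq hs bf bg'.
by under eq_fun do rewrite -mulN1r.
Qed.

(** For a finite measure the factor |I|^(1/p) suffices; 1 is added to it so that one can divide by
    [V]. *)
Lemma cLnormp_le_Linfty : exists2 V : R, 0 < V & forall f (e : R), cmeasurable f ->
  0 <= e -> (cLnorm m +oo%E f <= e%:E)%E -> (cLnormp f <= (e * V)%:E)%E.
Proof.
exists (vol m setT `^ p^-1 + 1) => [|f e mf e0 fe]; first by rewrite ltr_wpDl ?powR_ge0.
have ae := iffLR (cLnorm_infty_leP m f e0) fe.
apply: le_trans (cLnorm_bounded hp mf e0 ae) _.
by rewrite lee_fin ler_wpM2l// lerDl.
Qed.

(** The limit is found in L^oo, hence also in L^p. Lower semicontinuity of the standard cost then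
    places [u i - f] in the Besov space with a small norm. *)
Lemma besov_Linfty_complete (u : nat -> T -> R[i]) : (forall n, A (u n)) ->
  (forall e : R, 0 < e -> exists n0 : nat, forall i j : nat,
    (n0 <= i)%N -> (n0 <= j)%N -> (N (u i \- u j)%R < e%:E)%E) ->
  exists2 f, A f & (fun n : nat => N (u n \- f)) @ \oo --> 0%E.
Proof.
move=> Au uC.
have y1 : (1 <= +oo :> \bar R)%E by exact: leey.
have bu n : besov (u n) by have [] := Au n.
have lu n : cLp m +oo%E (u n) by have [] := Au n.
have both e : 0 < e -> exists n0 : nat, forall i j : nat,
    (n0 <= i)%N -> (n0 <= j)%N ->
    (besov_norm (fun x => u i x - u j x)%R <= e%:E)%E /\
    (cLnorm m +oo%E (fun x => u i x - u j x)%R <= e%:E)%E.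
  move=> /uC[n0 h]; exists n0 => i j ni nj; have /ltW := h _ _ ni nj.
  rewrite /besov_Linfty_norm => hN; split; apply: le_trans hN.
    by rewrite leeDl// cLnorm_ge0.
  by rewrite leeDr// besov_norm_ge0.
have [||f mf fu] := @Linfty_complete _ _ _ m u.
- by move=> n; have [] := lu n.
- by move=> e /both[n0 h]; exists n0 => i j ni nj; have [] := h _ _ ni nj.
have luf n : cLp m +oo%E (fun x => u n x - f x).
  split; first exact: cmeasurableB (lu n).1 mf.
  have [K hK] := fu 1 ltr01.
  have -> : (fun x => u n x - f x) = (fun x => (u n x - u K x) + (u K x - f x)).
    by apply/funext => x; rewrite addrA subrK.
  have h1 := cLpB y1 (lu n) (lu K).
  apply: le_lt_trans (cLnormD m y1 h1.1 (cmeasurableB (lu K).1 mf)) _.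
  apply: lte_add_pinfty; first exact: h1.2.
  by apply: le_lt_trans (hK K (leqnn _)) _; exact: ltry.
have luf_p n := cLp_infty_sub hp (luf n).
have C0 := standard_const_ge0 hP hs.
have [V V0 NmV] := cLnormp_le_Linfty.
(* [u i - u j] tends to [u i - f] in L^p as j grows, and its standard cost is
   at most standard_const * e. *)
have key e : 0 < e -> exists n0 : nat, forall i : nat, (n0 <= i)%N ->
    besov (fun x => u i x - f x) /\
    (besov_norm (fun x => u i x - f x)%R <= (standard_const l1 l2 s p * e)%:E)%E.
  move=> e0; have [n0 h0] := both _ e0; exists n0 => i ni.
  have approx e' : 0 < e' -> exists2 j : nat, (n0 <= j)%N &
      (cLnormp (fun x => (u i x - f x) - (u i x - u j x)) <= e'%:E)%E.
    move=> e'0; have [K hK] := fu _ (divr_gt0 e'0 V0).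
    exists (maxn n0 K); first exact: leq_maxl.
    have -> : (fun x => (u i x - f x) - (u i x - u (maxn n0 K) x)) =
        (fun x => u (maxn n0 K) x - f x) by apply/funext => x; ring.
    have eV : 0 <= e' / V by rewrite divr_ge0// ltW.
    have := NmV _ _ (luf (maxn n0 K)).1 eV (hK _ (leq_maxr _ _)).
    by rewrite divfK ?gt_eqF.
  apply: (besov_of_standard hP hp hq hs (luf_p i)); first last.
  - move=> K; apply: (trunc_cost_avg_approx hP hp hq (luf_p i)) => e' /approx[j nj hj].
    have bij := besovB (bu i) (bu j).
    exists (fun x => u i x - u j x); split; [exact: bij.1|exact: hj|].
    have [B B0 nB] := besov_norm_fin hP hp hq hs bij.
    apply: le_trans (besov_standard_le hP hp hq hs K bij nB) _.
    by rewrite ler_wpM2l// -lee_fin -nB; have [] := h0 _ _ ni nj.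
  - by rewrite mulr_ge0// ltW.
  - apply: (martingale_cvg_approx hP hp (luf_p i)) => e' /approx[j nj hj].
    have bij := besovB (bu i) (bu j).
    exists (fun x => u i x - u j x); split; [exact: bij.1| |exact: hj].
    exact: (besov_martingale_cvg hP hp hq hs bij).
exists f.
  have [n0 h0] := key _ ltr01; have [bn _] := h0 _ (leqnn _).
  (* Only the differences [u i - f] have been controlled so far; [f] itself is recovered by
     subtraction. *)
  have E : f = (fun x => u n0 x - (u n0 x - f x)) by apply/funext => x; ring.
  split; first by rewrite E; exact: besovB.
  by rewrite E; exact: cLpB.
apply/cvge0P => [n|e e0].
  by rewrite adde_ge0 ?besov_norm_ge0 ?cLnorm_ge0.
have C1 : 0 < standard_const l1 l2 s p + 1 by rewrite ltr_wpDl.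
have [n0 h0] := key _ (divr_gt0 e0 C1); have [n1 h1] := fu _ (divr_gt0 e0 C1).
exists (maxn n0 n1) => n; rewrite geq_max => /andP[/h0[_ {}h0] /h1 {}h1].
apply: le_trans (leeD h0 h1) _; rewrite -EFinD lee_fin -[X in _ + X <= _]mul1r.
by rewrite -mulrDl mulrCA divff ?gt_eqF// mulr1.
Qed.

End completeness.

Theorem proposition19p1 (R : realType) (d : measure_display)
  (T : measurableType d) (m : {finite_measure set T -> \bar R})
  (l1 l2 : R) (P : nat -> set (set T)) (hP : good_grid m l1 l2 P)
  (s p : R) (q : \bar R) (hp : 1 <= p) (hq : (1 <= q)%E) (hs : 0 < s < p^-1) :
  (forall f g : T -> R[i],
     besov_Linfty m P s p q f -> besov_Linfty m P s p q g ->
     besov_Linfty m P s p q (f \* g) /\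
     (besov_norm m P s p q (f \* g)%R + cLnorm m +oo (f \* g)%R <=
      (C_e l1 l2 s p)%:E * C_o m P l2 s q
      * (besov_norm m P s p q f + cLnorm m +oo f)
      * (besov_norm m P s p q g + cLnorm m +oo g))%E) /\
  quasi_banach_algebra m (besov_Linfty m P s p q)
    (besov_Linfty_norm m P s p q).
Proof.
have p1 := lee1_EFin hp.
have y1 : (1 <= +oo :> \bar R)%E by exact: leey.
have muloo f g := @besov_Linfty_mul _ _ _ _ _ _ _ hP _ _ _ hp hq hs f g.
have Nge0 f : (0 <= besov_Linfty_norm m P s p q f)%E.
  by rewrite /besov_Linfty_norm adde_ge0 ?cLnorm_ge0// (besov_norm_ge0 m P s p hq).
split.
  move=> f g Af Ag; have [Afg h] := muloo _ _ Af Ag; split; first exact: Afg.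
  apply: (le_trans h); rewrite -[leLHS]muleA -[leRHS]muleA.
  apply: lee_wpmul2r; last exact: (standard_const_le_CeCo hP q hp hs).
  by rewrite mule_ge0// Nge0.
split.
- by move=> f [_ []].
- move=> f g [bf lf] mg fg.
  have [bg Ng] := besov_ae_eq hP hp hq hs bf mg fg.
  have Lg := cLnorm_ae_eq y1 lf.1 mg fg.
  split; last by rewrite /besov_Linfty_norm Ng Lg.
  by split => //; split => //; rewrite -Lg; exact: lf.2.
- by split; [exact: (besov0 hP hp hq hs).1|exact: cLp0].
- move=> f g [bf lf] [bg lg]; split; last exact: cLpD.
  exact: (besov_normD hP hp hq hs bf bg).1.
- move=> c f [bf lf]; split; last exact: cLpZ.
  exact: (besov_normZ_le hP hp hq hs c bf).1.
- move=> f [bf lf]; rewrite Nge0 /=.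
  have [B _ fB] := besov_norm_fin hP hp hq hs bf.
  by rewrite /besov_Linfty_norm fB lte_add_pinfty ?ltry// lf.2.
- move=> f [bf lf]; split=> [Nf0|f0].
    have L0 : (cLnorm m +oo f <= 0)%E.
      by rewrite -Nf0 /besov_Linfty_norm leeDr// (besov_norm_ge0 m P s p hq).
    have := iffLR (cLnorm_infty_leP m f (lexx 0)) L0.
    apply: filterS => x fx _; apply: Normc.eq0_normc; apply/eqP.
    by rewrite eq_le fx normc_ge0.
  have m0 := cmeasurable_cst (T := T) (0 : R[i]).
  have [_ N0] := besov_ae_eq hP hp hq hs bf m0 f0.
  rewrite /besov_Linfty_norm -N0 (besov0 hP hp hq hs).2.
  by rewrite (cLnorm_ae_eq y1 lf.1 m0 f0) cLnorm0// adde0.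
- move=> f g [bf lf] [bg lg]; rewrite /besov_Linfty_norm addeACA; apply: leeD.
    exact: (besov_normD hP hp hq hs bf bg).2.
  exact: cLnormD lf.1 lg.1.
- move=> c f [bf lf].
  have le a h : besov_Linfty m P s p q h ->
      (besov_Linfty_norm m P s p q (fun x => a * h x)%R <=
       (Normc.normc a)%:E * besov_Linfty_norm m P s p q h)%E.
    move=> [bh lh]; rewrite /besov_Linfty_norm ge0_muleDr ?cLnorm_ge0//; last first.
      exact: (besov_norm_ge0 m P s p hq).
    apply: leeD; first exact: (besov_normZ_le hP hp hq hs a bh).2.
    by rewrite (cLnormZ m a y1 lh.1).
  apply/eqP; rewrite eq_le le//=.
  have [->|c0] := eqVneq c 0; first by rewrite Normc.normc0 mul0e Nge0.
  have nc0 : 0 < Normc.normc c by rewrite lt_def normc_eq0 c0 normc_ge0.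
  have Acf : besov_Linfty m P s p q (fun x => c * f x).
    by split; [exact: (besov_normZ_le hP hp hq hs c bf).1|exact: cLpZ].
  (* The missing inequality: the bound for [c^-1] applied to [c * f]. *)
  have := le c^-1 _ Acf; rewrite Normc.normcV lee_pdivlMl//.
  by under eq_fun do rewrite mulKf//.
- by move=> u Au uC; exact: (besov_Linfty_complete hP hp hq hs Au uC).
- by move=> f g Af Ag; have [] := muloo _ _ Af Ag.
(* A real constant is required, and [standard_const] is one by construction, whereas [C_o] is an
   extended real. *)
- by exists (standard_const l1 l2 s p) => f g Af Ag; have [] := muloo _ _ Af Ag.
Qed.
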